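(* Let $X\in\mathcal{M}_g$ be a closed hyperbolic surface of genus $g$, and fix a constant $l$ with $0<l\leq\mathrm{injrad}(X)$, with respect to which $\varepsilon$-density in the unit tangent bundle $UT(X)$ is defined. There exists a constant $C_X>0$ such that for all $\varepsilon$ with $0<\varepsilon\leq\frac12$ there exists a closed geodesic $\gamma_\varepsilon$ on $X$ that is $\varepsilon$-dense in $UT(X)$ and such that $$\ell(\gamma_\varepsilon)\leq C_X\,\frac{1}{\varepsilon^2}\,\log\left(\frac1\varepsilon\right).$$
   Context: $\mathcal{M}_g$ is the moduli space of closed orientable hyperbolic surfaces of genus $g\geq 2$. $\ell(\cdot)$ denotes length and $\mathrm{injrad}(X)$ is the minimum injectivity radius of $X$. Closed geodesics are not required to be simple. Unit tangent vectors are represented by oriented geodesic segments: given $X$ and a constant $l\leq\mathrm{injrad}(X)$, a curve $\gamma$ on $X$ is said to be $\varepsilon$-dense in $UT(X)$ if every oriented geodesic segment on $X$ of length $l$ is contained in an $\varepsilon$-neighborhood of $\gamma$. *)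

(* Defs.v *)
From HB Require Import structures.
From mathcomp Require Import all_boot all_order all_algebra.
From mathcomp Require Import generic_quotient.
From mathcomp Require Import all_classical all_reals all_analysis.
From mathcomp Require Import complex.
Set Implicit Arguments.
Unset Strict Implicit.
Unset Printing Implicit Defensive.
Import Order.TTheory GRing.Theory Num.Theory.
Import numFieldNormedType.Exports.
Local Open Scope classical_set_scope.
Local Open Scope ring_scope.
Local Open Scope complex_scope.
Local Open Scope quotient_scope.

(** * The hyperbolic plane (upper half-plane model, curvature -1) *)

Record uhp (R : realType) := Uhp { uhp_val :> R[i]; _ : 0 < complex.Im uhp_val }.
HB.instance Definition _ (R : realType) := [isSub for @uhp_val R].
HB.instance Definition _ (R : realType) := [Choice of uhp R by <:].

Definition uhp_coord (R : realType) (z : uhp R) : R * R := (complex.Re z, complex.Im z).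

HB.instance Definition _ (R : realType) :=
  Topological.copy (uhp R) (initial_topology (@uhp_coord R)).

Definition arcosh (R : realType) (x : R) : R :=
  ln (x + Num.sqrt (x ^+ 2 - 1)).

Definition hdist (R : realType) (z w : uhp R) : R :=
  arcosh (1 + ((complex.Re z - complex.Re w) ^+ 2 + (complex.Im z - complex.Im w) ^+ 2)
              / (2 * complex.Im z * complex.Im w)).

Definition moebius (R : realType) (A : 'M[R]_2) (z : R[i]) : R[i] :=
  ((A 0 0)%:C * z + (A 0 1)%:C) / ((A 1 0)%:C * z + (A 1 1)%:C).

(** * Hyperbolic surfaces *)

(* An orientable complete hyperbolic surface is given as the quotient of the
   hyperbolic plane by a discrete subgroup of SL(2,R) whose image in
   PSL(2,R), the group of orientation-preserving isometries, acts freely.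
   The group may or may not contain -1, which acts trivially. *)
Record hyp_surface (R : realType) := HypSurface {
  deck : set 'M[R]_2;
  deck_det : forall A, deck A -> \det A = 1;
  deck_1 : deck 1%:M;
  deck_mul : forall A B, deck A -> deck B -> deck (A *m B);
  deck_inv : forall A, deck A -> deck (invmx A);
  deck_discrete : \forall A \near (1%:M : 'M[R]_2), deck A -> A = 1%:M;
  deck_free : forall A (z : uhp R),
    deck A -> moebius A z = z -> A = 1%:M \/ A = - 1%:M
}.

Section MoebiusFacts.
Variable R : realType.
Implicit Types (z : uhp R) (A B : 'M[R]_2).

Lemma moebius1 (z : R[i]) : moebius 1%:M z = z.
Proof. by rewrite /moebius !mxE /= !mulr1n !mulr0n mul1r mul0r addr0 add0r divr1. Qed.

Lemma moebius_den_neq0 A z : \det A = 1 ->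
  (A 1 0)%:C * (z : R[i]) + (A 1 1)%:C != 0.
Proof.
case: z => [[x y] /= y0] dA; rewrite eq_complex /=.
rewrite !mul0r !subr0 !addr0; apply/negP => /andP[/eqP h1 /eqP h2].
have c0 : A 1 0 = 0.
  by move/eqP: h2; rewrite mulf_eq0 (gt_eqF y0) orbF => /eqP.
have d0 : A 1 1 = 0 by move: h1; rewrite c0 mul0r add0r.
move/eqP: dA; rewrite (expand_det_row A 1) big1 ?(eq_sym 0) ?oner_eq0 // => i _.
have [->|->] : i = 0 \/ i = 1 by case: i => [[|[|//]] ?]; [left|right]; apply: val_inj.
  by rewrite c0 mul0r.
by rewrite d0 mul0r.
Qed.

Lemma moebiusM A B z : \det A = 1 -> \det B = 1 ->
  moebius (A *m B) z = moebius A (moebius B z).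
Proof.
move=> dA dB.
have nB := moebius_den_neq0 z dB.
have nAB : ((A *m B) 1 0)%:C * (z : R[i]) + ((A *m B) 1 1)%:C != 0.
  by apply: moebius_den_neq0; rewrite det_mulmx dA dB mulr1.
have E i j : ((A *m B) i j)%:C = (A i 0)%:C * (B 0 j)%:C + (A i 1)%:C * (B 1 j)%:C.
  rewrite mxE !big_ord_recl big_ord0 addr0 !rmorphD !rmorphM /=.
  by congr (_ + _ * _); congr ((_ _ _)%:C); apply: val_inj.
rewrite /moebius; move: nAB; rewrite !E => nAB.
set a := (A 0 0)%:C in nAB *; set b := (A 0 1)%:C in nAB *.
set c := (A 1 0)%:C in nAB *; set d := (A 1 1)%:C in nAB *.
set p := (B 0 0)%:C in nB nAB *; set q := (B 0 1)%:C in nB nAB *.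
set r := (B 1 0)%:C in nB nAB *; set s := (B 1 1)%:C in nB nAB *.
have den k m : k * ((p * (z : R[i]) + q) / (r * (z : R[i]) + s)) + m
    = ((k * p + m * r) * (z : R[i]) + (k * q + m * s)) / (r * (z : R[i]) + s).
  apply: (mulIf nB); rewrite mulrDl divfK // -mulrA divfK //.
  by rewrite !mulrDl !mulrDr !mulrA addrACA.
by rewrite !den invf_div mulrA divfK.
Qed.

End MoebiusFacts.

Section Surface.
Variables (R : realType) (X : hyp_surface R).

Definition same_orbit (z w : uhp R) : bool :=
  `[< exists2 A, deck X A & (w : R[i]) = moebius A z >].

Lemma same_orbit_refl : reflexive same_orbit.
Proof. by move=> z; apply/asboolP; exists 1%:M; [exact: deck_1|rewrite moebius1]. Qed.

Lemma same_orbit_sym : symmetric same_orbit.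
Proof.
suff H z w : same_orbit z w -> same_orbit w z by move=> z w; apply/idP/idP; exact: H.
move=> /asboolP[A XA wE]; apply/asboolP; exists (invmx A); first exact: deck_inv.
have dA := deck_det XA; have dA' := deck_det (deck_inv XA).
by rewrite wE -moebiusM // mulVmx ?moebius1 // unitmxE dA unitr1.
Qed.

Lemma same_orbit_trans : transitive same_orbit.
Proof.
move=> w z v /asboolP[A XA wE] /asboolP[B XB vE]; apply/asboolP.
exists (B *m A); first exact: deck_mul.
by rewrite vE wE moebiusM ?(deck_det XA) ?(deck_det XB).
Qed.

Canonical orbit_equiv :=
  EquivRel same_orbit same_orbit_refl same_orbit_sym same_orbit_trans.

Definition points : Type := quotient_topology {eq_quot orbit_equiv}.
HB.instance Definition _ := Topological.on points.
HB.instance Definition _ := Quotient.on points.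

Definition surface_proj (z : uhp R) : points := \pi_points z.

(** * Genus *)

Definition simple_closed_curve (c : R -> points) : Prop :=
  [/\ continuous c,
      forall t, c (t + 1) = c t &
      {in `[0, 1[ &, injective c}].

(* A family of [k] pairwise disjoint simple closed curves that does not
   disconnect the surface. *)
Definition nonseparating_family (k : nat) : Prop :=
  exists c : 'I_k -> R -> points,
    [/\ forall i, simple_closed_curve (c i),
        forall i j, i != j -> range (c i) `&` range (c j) = set0 &
        connected (~` \bigcup_(i in [set: 'I_k]) range (c i))].

Definition has_genus (g : nat) : Prop :=
  nonseparating_family g /\ forall k, nonseparating_family k -> (k <= g)%N.

(** * Injectivity radius *)

(* The exponential map at [surface_proj z] is the one at [z], which is a
   diffeomorphism onto the hyperbolic plane, followed by [surface_proj]. *)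
Definition injrad_at (z : uhp R) : \bar R :=
  ereal_sup [set r%:E | r in
    [set r : R | {in [set w | hdist z w < r] &, injective surface_proj}]].

Definition injrad : \bar R := ereal_inf (range injrad_at).

(** * Geodesics *)

(* Unit-speed geodesics of the hyperbolic plane; as geodesics of the plane
   are minimizing, they are the isometric embeddings of intervals. *)
Definition hgeodesic (I : set R) (c : R -> uhp R) : Prop :=
  {in I &, forall s t, hdist (c s) (c t) = `|s - t|}.

Definition geodesic_lift (I : set R) (c : R -> points) (ct : R -> uhp R) :=
  hgeodesic I ct /\ {in I, forall t, surface_proj (ct t) = c t}.

(* Since [surface_proj] is a local isometry, unit-speed geodesics of the
   surface are the projections of those of the plane. Being parametrized, they
   are oriented, and they need not be simple. *)
Definition geodesic (I : set R) (c : R -> points) : Prop :=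
  exists ct, geodesic_lift I c ct.

Definition closed_geodesic (c : R -> points) (L : R) : Prop :=
  [/\ 0 < L, geodesic setT c & forall t, c (t + L) = c t].

(* Oriented geodesic segments of length [l] stand for unit tangent vectors.
   Two of them are [eps]-close when they have lifts to the plane that stay at
   distance less than [eps] while travelled simultaneously, so that both
   position and direction are compared. *)
Definition segments_close (l eps : R) (c1 c2 : R -> points) : Prop :=
  exists ct1 ct2, [/\ geodesic_lift `[0, l] c1 ct1,
    geodesic_lift `[0, l] c2 ct2 &
    {in `[0, l], forall t, hdist (ct1 t) (ct2 t) < eps}].

Definition dense_in_UT (l eps : R) (gamma : R -> points) : Prop :=
  forall c, geodesic `[0, l] c ->
    exists s, segments_close l eps c (fun t => gamma (s + t)).

End Surface.

(* Main.v *)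
Require Import Defs.
From mathcomp Require Import all_boot all_order all_algebra.
From mathcomp Require Import generic_quotient.
From mathcomp Require Import all_classical all_reals all_analysis.
From mathcomp Require Import complex ring lra zify.
Set Implicit Arguments.
Unset Strict Implicit.
Unset Printing Implicit Defensive.
Import Order.TTheory GRing.Theory Num.Theory.
Import numFieldNormedType.Exports.
Local Open Scope classical_set_scope.
Local Open Scope ring_scope.

(* Write g.i for the point of the half-plane with frame g in SL(2,R) and
   a_t = diag(e^(t/2), e^(-t/2)), so that unit-speed geodesics are t |-> g a_t.i
   and cosh d(g.i, h.i) is half the squared Frobenius norm of g^-1 h.

   As the deck group D is cocompact and discrete, it fixes no line of R^2, and
   by compactness bounded elements of D bring any two lines to a definite
   angle.  Given frames g and h, flow g forward and h backward for a time T,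
   bring both into a fixed compact set by D, and make them transverse there:
   this yields S in D such that g^-1 S h = a_T A a_T with A bounded and |A_00|
   bounded below.  Such matrices contract the cones of vectors of slope, resp.
   inverse slope, O(e^-T), and this is stable under products.  So for a cyclic
   sequence of N frames the product of the connecting elements S is a hyperbolic
   element of D of translation length O(N T) whose axis, moved by D, passes by
   each frame with both endpoints O(e^-T) away from those of its geodesic.

   Modulo D and the flow a frame has two coordinates in a bounded set, so a net
   of N = O(eps^-2) frames and e^T of order 1/eps suffice. *)

(** * Two-by-two matrices of determinant one *)

Section TwoByTwo.
Variable R : comUnitRingType.
Implicit Types (A B : 'M[R]_2) (a b c d : R).

Definition mx2 a b c d : 'M[R]_2 :=
  \matrix_(i, j) (if i == 0 then if j == 0 then a else b
                  else if j == 0 then c else d).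

Lemma mx2E a b c d : ((mx2 a b c d 0 0 = a) * (mx2 a b c d 0 1 = b) *
  (mx2 a b c d 1 0 = c) * (mx2 a b c d 1 1 = d))%type.
Proof. by rewrite !mxE. Qed.

Lemma eq_mx2 A B : A 0 0 = B 0 0 -> A 0 1 = B 0 1 -> A 1 0 = B 1 0 ->
  A 1 1 = B 1 1 -> A = B.
Proof.
move=> h00 h01 h10 h11; apply/matrixP => i j.
have H (k : 'I_2) : k = 0 \/ k = 1.
  by case: k => [[|[|//]] ?]; [left|right]; apply: val_inj.
by case: (H i) => ->; case: (H j) => ->.
Qed.

Lemma mx2_eta A : A = mx2 (A 0 0) (A 0 1) (A 1 0) (A 1 1).
Proof. by apply: eq_mx2; rewrite !mx2E. Qed.

Lemma mulmx2E A B i j : (A *m B) i j = A i 0 * B 0 j + A i 1 * B 1 j.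
Proof.
by rewrite mxE !big_ord_recl big_ord0 addr0; congr (_ + _ * _);
  congr (_ _ _); apply: val_inj.
Qed.

Lemma mulmx2 a b c d a' b' c' d' : mx2 a b c d *m mx2 a' b' c' d' =
  mx2 (a * a' + b * c') (a * b' + b * d') (c * a' + d * c') (c * b' + d * d').
Proof. by apply: eq_mx2; rewrite mulmx2E !mx2E. Qed.

Lemma det2 A : \det A = A 0 0 * A 1 1 - A 0 1 * A 1 0.
Proof.
rewrite (expand_det_row A 0) !big_ord_recl big_ord0 addr0 /cofactor !det_mx11.
rewrite !mxE /= expr0 expr1 mul1r mulN1r mulrN.
by congr (_ * _ - _ * _); congr (_ _ _); apply: val_inj.
Qed.

Lemma det_mx2 a b c d : \det (mx2 a b c d) = a * d - b * c.
Proof. by rewrite det2 !mx2E. Qed.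

Lemma mx2_1 : 1%:M = mx2 1 0 0 1.
Proof. by apply: eq_mx2; rewrite !mx2E !mxE. Qed.

Lemma opp_mx2 a b c d : - mx2 a b c d = mx2 (- a) (- b) (- c) (- d).
Proof. by apply: eq_mx2; rewrite mxE !mx2E. Qed.

Lemma unit_det1 A : \det A = 1 -> A \in unitmx.
Proof. by move=> dA; rewrite unitmxE dA unitr1. Qed.

Lemma mulmxV1 A B : \det A = 1 -> A *m B = 1%:M -> invmx A = B.
Proof.
by move=> /unit_det1 uA AB; rewrite -[LHS]mulmx1 -AB mulKmx.
Qed.

Lemma invmx2 A : \det A = 1 ->
  invmx A = mx2 (A 1 1) (- A 0 1) (- A 1 0) (A 0 0).
Proof.
move=> dA; apply: mulmxV1 => //; rewrite mx2_1 -[RHS]/(_) {1}(mx2_eta A) mulmx2.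
by move: dA; rewrite det2 => dA; congr mx2; rewrite -?dA; ring.
Qed.

Lemma det_invmx1 A : \det A = 1 -> \det (invmx A) = 1.
Proof. by move=> dA; rewrite det_inv dA invr1. Qed.

Lemma det_mulmx1 A B : \det A = 1 -> \det B = 1 -> \det (A *m B) = 1.
Proof. by move=> dA dB; rewrite det_mulmx dA dB mulr1. Qed.

Lemma invmxM1 A B : \det A = 1 -> \det B = 1 ->
  invmx (A *m B) = invmx B *m invmx A.
Proof.
move=> dA dB; apply: mulmxV1; first exact: det_mulmx1.
by rewrite mulmxA mulmxK ?mulmxV ?unit_det1.
Qed.

Definition fro A : R := A 0 0 ^+ 2 + A 0 1 ^+ 2 + (A 1 0 ^+ 2 + A 1 1 ^+ 2).

Definition dg (e : R) : 'M[R]_2 := mx2 e 0 0 e^-1.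

Lemma det_dg e : e \is a GRing.unit -> \det (dg e) = 1.
Proof. by move=> e0; rewrite det_mx2 divrr // mul0r subr0. Qed.

Lemma dgM e f : e \is a GRing.unit -> f \is a GRing.unit ->
  dg e *m dg f = dg (e * f).
Proof.
move=> e0 f0; rewrite mulmx2 /dg !mulr0 !mul0r !addr0 !add0r.
by rewrite invrM // [f^-1 * _]mulrC.
Qed.

Lemma dg1 : dg 1 = 1%:M.
Proof. by rewrite /dg invr1 mx2_1. Qed.

Lemma invmx_dg e : e \is a GRing.unit -> invmx (dg e) = dg e^-1.
Proof.
by move=> e0; apply: mulmxV1; rewrite ?det_dg // dgM ?unitrV // divrr // dg1.
Qed.

End TwoByTwo.

(** * Frames and points of the half-plane *)

Section Frames.
Variable R : realType.
Implicit Types (A B g h k : 'M[R]_2) (z : uhp R) (s t x y : R).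

Let i0 : uhp R := @Uhp R (0 +i* 1)%C ltr01.

(** The Möbius image of i in coordinates, correct for determinant one. The default value of [insubd]
    is taken only when the lower row vanishes. *)
Definition pt A : uhp R := insubd i0
  ((A 0 0 * A 1 0 + A 0 1 * A 1 1) / (A 1 0 ^+ 2 + A 1 1 ^+ 2)
    +i* (A 1 0 ^+ 2 + A 1 1 ^+ 2)^-1)%C.

Lemma row_gt0 A : \det A = 1 -> 0 < A 1 0 ^+ 2 + A 1 1 ^+ 2.
Proof.
rewrite det2 => dA; rewrite lt_neqAle addr_ge0 ?sqr_ge0 // andbT eq_sym.
rewrite paddr_eq0 ?sqr_ge0 // !sqrf_eq0; apply/negP => /andP[/eqP c /eqP d].
by move: dA; rewrite c d !mulr0 subr0 => /esym/eqP; rewrite oner_eq0.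
Qed.

Lemma val_pt A : \det A = 1 -> uhp_val (pt A) =
  ((A 0 0 * A 1 0 + A 0 1 * A 1 1) / (A 1 0 ^+ 2 + A 1 1 ^+ 2)
    +i* (A 1 0 ^+ 2 + A 1 1 ^+ 2)^-1)%C.
Proof.
by move=> dA; apply: (insubdK i0); rewrite unfold_in /= invr_gt0 row_gt0.
Qed.

Lemma pt_opp A : pt (- A) = pt A.
Proof. by rewrite /pt !mxE !mulrNN !sqrrN. Qed.

Lemma uhp_eq (z w : uhp R) : complex.Re z = complex.Re w ->
  complex.Im z = complex.Im w -> z = w.
Proof.
by case: z w => [[x y] y0] [[x' y'] y0'] /= ex ey; apply: val_inj; rewrite /= ex ey.
Qed.

Lemma pt_surj z : exists2 A, \det A = 1 & pt A = z.
Proof.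
case: z => [[x y] y0] /=; have sy : Num.sqrt y != 0 by rewrite sqrtr_eq0 -ltNge.
have yE : y = Num.sqrt y ^+ 2 by rewrite sqr_sqrtr // ltW.
(* The affine map w |-> y w + x, normalized to determinant one. *)
exists (mx2 (Num.sqrt y) (x / Num.sqrt y) 0 (Num.sqrt y)^-1).
  by rewrite det_mx2; field.
have D : \det (mx2 (Num.sqrt y) (x / Num.sqrt y) 0 (Num.sqrt y)^-1) = 1.
  by rewrite det_mx2; field.
by apply: uhp_eq; rewrite val_pt //= !mx2E; [|rewrite [RHS]yE]; field.
Qed.

Lemma Re_moebius A (x y : R) : y != 0 -> \det A = 1 ->
  moebius A (x +i* y)%C =
  (((A 0 0 * x + A 0 1) * (A 1 0 * x + A 1 1) + A 0 0 * A 1 0 * y ^+ 2)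
     / ((A 1 0 * x + A 1 1) ^+ 2 + (A 1 0 * y) ^+ 2)
   +i* (y / ((A 1 0 * x + A 1 1) ^+ 2 + (A 1 0 * y) ^+ 2)))%C.
Proof.
rewrite det2 => y0 dA.
have D0 : (A 1 0 * x + A 1 1) ^+ 2 + (A 1 0 * y) ^+ 2 != 0.
  rewrite paddr_eq0 ?sqr_ge0 // !sqrf_eq0 mulf_eq0 (negPf y0) orbF.
  apply/negP => /andP[/eqP c /eqP d]; move: dA c.
  rewrite d mul0r add0r mulr0 subr0 => + d1.
  by rewrite d1 mulr0 => /esym/eqP; rewrite oner_eq0.
apply/eqP; rewrite eq_complex /moebius /=.
rewrite !mul0r !subr0 !addr0; apply/andP; split; apply/eqP.
  by field.
by rewrite -[X in _ = X / _]mul1r -dA; field.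
Qed.

Lemma moebius_pt A B : \det A = 1 -> \det B = 1 ->
  moebius A (pt B) = uhp_val (pt (A *m B)).
Proof.
move=> dA dB; rewrite !val_pt ?det_mulmx1 // Re_moebius ?invr_eq0 //; last first.
  by rewrite gt_eqF // row_gt0.
have := row_gt0 (det_mulmx1 dA dB); have := row_gt0 dB.
rewrite !mulmx2E; move: dA dB; rewrite !det2 => dA dB.
set a := A 0 0 in dA *; set b := A 0 1 in dA *;
set c := A 1 0 in dA *; set d := A 1 1 in dA *.
set p := B 0 0 in dB *; set q := B 0 1 in dB *;
set r := B 1 0 in dB *; set s := B 1 1 in dB *.
move=> h1 h2; have n1 : r ^+ 2 + s ^+ 2 != 0 by rewrite gt_eqF.
have n2 : (c * p + d * r) ^+ 2 + (c * q + d * s) ^+ 2 != 0 by rewrite gt_eqF.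
(* This is |c w + d|^2 at w = B.i, by which [A] divides the imaginary part. The determinant ps - qr,
   equal to 1, is inserted to obtain an identity of rational functions. *)
have E : (c * ((p * r + q * s) / (r ^+ 2 + s ^+ 2)) + d) ^+ 2 +
         (c * (r ^+ 2 + s ^+ 2)^-1) ^+ 2 =
         ((c * p + d * r) ^+ 2 + (c * q + d * s) ^+ 2) / (r ^+ 2 + s ^+ 2).
  rewrite -[(c * (_)^-1)](_ : c * (p * s - q * r) / (r ^+ 2 + s ^+ 2) = _).
    by field.
  by rewrite dB mulr1.
rewrite E; apply/eqP; rewrite eq_complex /=; apply/andP; split; apply/eqP.
  rewrite -[((_)^-1) ^+ 2](_ : ((p * s - q * r) / (r ^+ 2 + s ^+ 2)) ^+ 2 = _).
    by field; rewrite n1 n2.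
  by rewrite dB mul1r.
by field; rewrite n1 n2.
Qed.

Lemma pt_mull A B C : \det A = 1 -> \det B = 1 -> \det C = 1 -> pt B = pt C ->
  pt (A *m B) = pt (A *m C).
Proof.
by move=> dA dB dC E; apply: val_inj; rewrite -[LHS]moebius_pt // E moebius_pt.
Qed.

(** The left side is the hyperbolic cosine of the distance. Both sides depend only on the Gram
    matrices of determinant one A A^T and B B^T: [fro (invmx A *m B)] is the trace of (A A^T)^-1 (B
    B^T). *)
Lemma fro_pt A B : \det A = 1 -> \det B = 1 ->
  1 + ((complex.Re (pt A) - complex.Re (pt B)) ^+ 2
       + (complex.Im (pt A) - complex.Im (pt B)) ^+ 2)
      / (2 * complex.Im (pt A) * complex.Im (pt B)) = fro (invmx A *m B) / 2.
Proof.
move=> dA dB; rewrite !val_pt //= /fro invmx2 //.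
have := row_gt0 dA; have := row_gt0 dB.
rewrite !mulmx2E !mx2E; move: dA dB; rewrite !det2 => dA dB.
set a := A 0 0 in dA *; set b := A 0 1 in dA *;
set c := A 1 0 in dA *; set d := A 1 1 in dA *.
set p := B 0 0 in dB *; set q := B 0 1 in dB *;
set r := B 1 0 in dB *; set s := B 1 1 in dB *.
move=> h1 h2; have n1 : r ^+ 2 + s ^+ 2 != 0 by rewrite gt_eqF.
have n2 : c ^+ 2 + d ^+ 2 != 0 by rewrite gt_eqF.
have e1 : (a ^+ 2 + b ^+ 2) * (c ^+ 2 + d ^+ 2) = 1 + (a * c + b * d) ^+ 2.
  by rewrite -[1](expr1n _ 2) -dA; ring.
have e2 : (p ^+ 2 + q ^+ 2) * (r ^+ 2 + s ^+ 2) = 1 + (p * r + q * s) ^+ 2.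
  by rewrite -[1](expr1n _ 2) -dB; ring.
set u := a * c + b * d in e1 *; set v := p * r + q * s in e2 *.
set D := c ^+ 2 + d ^+ 2 in n2 e1 *; set S := r ^+ 2 + s ^+ 2 in n1 e2 *.
rewrite -[RHS](_ : ((p ^+ 2 + q ^+ 2) * D + S * (a ^+ 2 + b ^+ 2) - 2 * u * v) / 2 = _).
  rewrite -(mulfK n1 (p ^+ 2 + q ^+ 2)) -(mulfK n2 (a ^+ 2 + b ^+ 2)) e1 e2.
  by field; rewrite n1 n2.
by rewrite /D /S /u /v; congr (_ / _); ring.
Qed.

Lemma hdist_pt A B : \det A = 1 -> \det B = 1 ->
  hdist (pt A) (pt B) = arcosh (fro (invmx A *m B) / 2).
Proof. by move=> dA dB; rewrite /hdist fro_pt. Qed.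

End Frames.

(** * Geodesics of the plane as orbits of the diagonal flow *)

Section Lines.
Variable R : realType.
Implicit Types (A B g h k : 'M[R]_2) (z : uhp R) (s t x y l : R).

Definition flow t : 'M[R]_2 := dg (expR (t / 2)).

Lemma unit_gt0 x : 0 < x -> x \is a GRing.unit.
Proof. by move=> x0; rewrite unitfE gt_eqF. Qed.

Lemma unit_expR t : expR t \is a GRing.unit.
Proof. exact/unit_gt0/expR_gt0. Qed.

Lemma det_flow t : \det (flow t) = 1.
Proof. exact/det_dg/unit_expR. Qed.

Lemma flowD s t : flow (s + t) = flow s *m flow t.
Proof. by rewrite /flow dgM ?unit_expR // -expRD mulrDl. Qed.

Lemma invmx_flow t : invmx (flow t) = flow (- t).
Proof. by rewrite /flow invmx_dg ?unit_expR // -expRN mulNr. Qed.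

Lemma dg_flow (e : R) : 0 < e -> dg e = flow (2 * ln e).
Proof. by move=> e0; rewrite /flow [2 * _]mulrC mulfK ?lnK // pnatr_eq0. Qed.

Lemma expR_half t : expR (t / 2) ^+ 2 = expR t.
Proof. by rewrite expr2 -expRD; congr expR; field. Qed.

Lemma fro_flow t : fro (flow t) = expR t + expR (- t).
Proof.
by rewrite /fro !mx2E exprVn expR_half -expRN !expr0n /= addr0 add0r.
Qed.

Lemma fro_ge0 A : 0 <= fro A.
Proof. by rewrite /fro !addr_ge0 ?sqr_ge0. Qed.

(** Cauchy-Schwarz for each row of [A] and column of [B]; by Lagrange's identity the defects are the
    four squares supplied to [nra]. *)
Lemma fro_mul A B : fro (A *m B) <= fro A * fro B.
Proof.
rewrite /fro !mulmx2E; move: (A 0 0) (A 0 1) (A 1 0) (A 1 1) => a b c d.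
move: (B 0 0) (B 0 1) (B 1 0) (B 1 1) => p q r s.
have := sqr_ge0 (a * r - b * p); have := sqr_ge0 (a * s - b * q).
have := sqr_ge0 (c * r - d * p); have := sqr_ge0 (c * s - d * q); nra.
Qed.

Lemma fro_ge2 A : \det A = 1 -> 2 <= fro A.
Proof.
rewrite det2 /fro => dA.
have := sqr_ge0 (A 0 0 - A 1 1); have := sqr_ge0 (A 0 1 + A 1 0).
rewrite !sqrrD !sqrrN; lra.
Qed.

Lemma arcosh_cosh t : arcosh ((expR t + expR (- t)) / 2) = `|t|.
Proof.
wlog t0 : t / 0 <= t.
  move=> W; case: (leP 0 t) => [|/ltW t0]; first exact: W.
  by rewrite -normrN -W ?oppr_ge0 // opprK addrC.
have le : expR (- t) <= expR t by rewrite ler_expR; lra.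
rewrite /arcosh [X in Num.sqrt X](_ : _ = ((expR t - expR (- t)) / 2) ^+ 2).
  rewrite sqrtr_sqr ger0_norm; last by rewrite divr_ge0 // subr_ge0.
  by rewrite ger0_norm // -[RHS]expRK; congr ln; field.
by have := expRxMexpNx_1 t => E; lra.
Qed.

Lemma arcosh_eq x t : 1 <= x -> arcosh x = t -> 2 * x = expR t + expR (- t).
Proof.
move=> x1; have x2 : 0 <= x ^+ 2 - 1 by rewrite subr_ge0 exprn_ege1.
have s0 := sqrtr_ge0 (x ^+ 2 - 1).
rewrite /arcosh => <-; rewrite expRN lnK ?posrE; last lra.
have n0 : x + Num.sqrt (x ^+ 2 - 1) != 0 by lra.
have -> : (x + Num.sqrt (x ^+ 2 - 1))^-1 = x - Num.sqrt (x ^+ 2 - 1).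
  apply: (mulfI n0); rewrite mulfV //; by rewrite mulrC -subr_sqr sqr_sqrtr //; ring.
lra.
Qed.

(** As ln (1 + y) <= y, the left side is at most x + sqrt (2 x + x^2), where x is at most eps / 16
    and the root at most 3/4 eps. *)
Lemma arcosh_small x (eps : R) : 0 < eps -> eps <= 1 / 2 -> 0 <= x ->
  x <= eps ^+ 2 / 8 -> arcosh (1 + x) < eps.
Proof.
move=> e0 e1 x0 xle; rewrite /arcosh.
have -> : (1 + x) ^+ 2 - 1 = 2 * x + x ^+ 2 by ring.
have E2 : 0 < eps ^+ 2 by rewrite exprn_gt0.
have E3 : eps ^+ 2 <= eps * (1 / 2) by rewrite expr2 ler_pM2l.
have x1 : x ^+ 2 <= x by rewrite expr2 ler_piMr //; lra.
have S : Num.sqrt (2 * x + x ^+ 2) <= 3 / 4 * eps.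
  rewrite -[leRHS]ger0_norm; last lra.
  rewrite -sqrtr_sqr ler_sqrt ?sqr_ge0 // exprMn; lra.
have s0 := sqrtr_ge0 (2 * x + x ^+ 2).
rewrite -addrA; apply: le_lt_trans (le_ln1Dx _) _; first by lra.
lra.
Qed.

Lemma hdist_line G s t : \det G = 1 ->
  hdist (pt (G *m flow s)) (pt (G *m flow t)) = `|s - t|.
Proof.
move=> dG; rewrite hdist_pt ?det_mulmx1 ?det_flow //.
rewrite invmxM1 ?det_flow // -mulmxA (mulKmx (unit_det1 dG)) invmx_flow -flowD.
by rewrite fro_flow arcosh_cosh -normrN; congr `|_|; ring.
Qed.

Lemma hgeodesic_line G (I : set R) : \det G = 1 ->
  hgeodesic I (fun t => pt (G *m flow t)).
Proof. by move=> dG s t _ _; exact: hdist_line. Qed.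

(* [A *m A^T] determines [pt A], and it is diagonalized by a rotation. *)
Lemma pt_polar k l : \det k = 1 -> 0 < l -> fro k = expR l + expR (- l) ->
  exists g, [/\ \det g = 1, pt g = pt 1%:M & pt (g *m flow l) = pt k].
Proof.
move=> dk l0 kl; have L1 : 1 < expR l by rewrite expR_gt1.
have := expRxMexpNx_1 l; move: kl; rewrite expRN; set L := expR l in L1 *.
have [V VE] : exists V, V = L^-1 by exists L^-1.
rewrite -VE => kl LV; have L0 : 0 < L by lra.
have V0 : 0 < V by rewrite VE invr_gt0.
have LVlt : V < L by nra.
have D0 := row_gt0 dk; move: dk kl; rewrite det2 /fro => dk.
set A := k 0 0 ^+ 2 + k 0 1 ^+ 2; set D := k 1 0 ^+ 2 + k 1 1 ^+ 2 in D0 *.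
pose B := k 0 0 * k 1 0 + k 0 1 * k 1 1 => kl.
have ADB : A * D = 1 + B ^+ 2 by rewrite -[1](expr1n _ 2) -dk /A /D /B; ring.
(* It suffices to rotate diag(L, V) into the Gram matrix of [k], with entries A, B, D: its lower
   row, B and D, determines the point. *)
have rot p q : p ^+ 2 + q ^+ 2 = 1 -> q ^+ 2 * L + p ^+ 2 * V = D ->
    p * q * (L - V) = B ->
    exists g, [/\ \det g = 1, pt g = pt 1%:M & pt (g *m flow l) = pt k].
  move=> pq1 E1 E2.
  have dg1 : \det (mx2 p (- q) q p) = 1 by rewrite det_mx2 -pq1; ring.
  have dk' : \det k = 1 by rewrite det2.
  have d1 : \det (1%:M : 'M[R]_2) = 1 by rewrite det1.
  have h2 : expR (l / 2) ^+ 2 = L by rewrite expR_half.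
  have h3 : (expR (l / 2))^-1 ^+ 2 = V by rewrite exprVn h2 VE.
  exists (mx2 p (- q) q p); split => //.
    apply: uhp_eq; rewrite !val_pt //= mx2_1 !mx2E; last first.
      by rewrite !expr0n !expr1n /= addrC pq1; congr (_^-1); ring.
    by rewrite mulNr [q * p]mulrC subrr !mul0r mulr0 addr0 mul0r.
  have dgf := det_mulmx1 dg1 (det_flow l).
  have EB : (q * expR (l / 2)) ^+ 2 + (p * (expR (l / 2))^-1) ^+ 2 = D.
    by rewrite !exprMn h2 h3.
  apply: uhp_eq; rewrite !val_pt //= mulmx2 !mx2E !mulr0 !addr0 !add0r EB //.
  congr (_ / _); by rewrite -/B -E2 -h3 -h2; ring.
(* A diagonal entry of a symmetric matrix lies between the eigenvalues, here V and L. *)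
have ineq : 0 <= (A - V) * (L - A).
  have -> : (A - V) * (L - A) = B ^+ 2; last exact: sqr_ge0.
  have -> : B ^+ 2 = A * D - 1 by lra.
  have -> : D = L + V - A by lra.
  lra.
have AL : V <= A <= L by nra.
(* If A = V, the Gram matrix is diagonal with the eigenvalues in the opposite order, and a quarter
   turn exchanges them. *)
have [a0|a0] := eqVneq A V.
  have B0 : B = 0.
    have DL : D = L by lra.
    by apply/eqP; rewrite -sqrf_eq0; apply/eqP; move: ADB LV;
       rewrite a0 DL; lra.
  apply: (rot 0 1); rewrite ?expr0n ?expr1n /= ?B0 ?mul0r ?addr0 ?add0r //; lra.
have p2 : 0 < (A - V) / (L - V).
  rewrite divr_gt0 // subr_gt0 // lt_neqAle eq_sym a0; case/andP: AL => -> //.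
have n1 : L - V != 0 by lra.
pose p := Num.sqrt ((A - V) / (L - V)).
have pE : p ^+ 2 = (A - V) / (L - V) by rewrite sqr_sqrtr // ltW.
have p0 : p != 0 by rewrite -sqrf_eq0 pE gt_eqF.
pose q := B / (p * (L - V)).
have B2 : B ^+ 2 = (A - V) * (L - A).
  have -> : B ^+ 2 = A * D - 1 by lra.
  have -> : D = L + V - A by lra.
  lra.
have a1 : A - V != 0 by rewrite subr_eq0.
have qE : q ^+ 2 = (L - A) / (L - V).
  by rewrite exprMn exprVn exprMn pE B2; field; rewrite a1 n1.
apply: (rot p q).
- by rewrite pE qE; field.
- rewrite pE qE; have -> : D = L + V - A by lra.
  by field.
- by rewrite /q; field; rewrite n1 p0.
Qed.

(** The two hypotheses give the distances of the point to i and to e^l i. They are two independent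
    linear equations in the diagonal entries A and D of the Gram matrix of [k], solved by A = e^t
    and D = e^-t; then A D = 1 + B^2 forces B = 0. *)
Lemma pt_flow_uniq k l t : \det k = 1 -> 0 < l ->
  fro k = expR t + expR (- t) ->
  fro (flow (- l) *m k) = expR (l - t) + expR (t - l) -> pt k = pt (flow t).
Proof.
move=> dk l0; have L1 : 1 < expR l by rewrite expR_gt1.
have := expRxMexpNx_1 l; have := expRxMexpNx_1 t.
have h : (expR (- l / 2)) ^+ 2 = expR (- l) by rewrite expR_half.
have h' : (expR (- l / 2))^-1 ^+ 2 = expR l by rewrite exprVn h expRN invrK.
rewrite /fro !mulmx2E !mx2E !mul0r !addr0 !add0r !exprMn h h' -!mulrDr.
rewrite !expRD.
move: (expR_gt0 t) (expR_gt0 (- t)) (expR_gt0 (- l)).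
have D0 := row_gt0 dk.
set A := k 0 0 ^+ 2 + k 0 1 ^+ 2; set D := k 1 0 ^+ 2 + k 1 1 ^+ 2 in D0 *.
pose B := k 0 0 * k 1 0 + k 0 1 * k 1 1.
have ADB : A * D = 1 + B ^+ 2.
  move: dk; rewrite det2 => dk'.
  by rewrite -[1](expr1n _ 2) -dk' /A /D /B; ring.
set L := expR l in L1 *; set T := expR t; set T' := expR (- t); set L' := expR (- l).
move=> T0 T0' L0' TT LL e1 e2.
have DE : D = T'.
  have : (L - L') * (D - T') = 0 by nra.
  move/eqP; rewrite mulf_eq0 => /orP[/eqP|/eqP]; last lra.
  have : L' < L by nra.
  lra.
have AE : A = T by lra.
have B0 : B = 0 by apply/eqP; rewrite -sqrf_eq0; apply/eqP; move: ADB; rewrite AE DE; lra.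
have h2 : (expR (t / 2))^-1 ^+ 2 = T' by rewrite exprVn expR_half /T' expRN.
apply: uhp_eq; rewrite !val_pt ?det_flow //= -/B -/D !mx2E.
  by rewrite B0 !mul0r !mulr0 addr0 mul0r.
by rewrite DE h2 expr0n add0r.
Qed.

(** The frame [g] is found from the two endpoints by the polar decomposition [pt_polar]. Every other
    point of the segment is then determined by its distances to these endpoints. *)
Lemma hgeodesic_flow (l : R) (c : R -> uhp R) : 0 < l ->
  hgeodesic `[0, l] c ->
  exists2 g, \det g = 1 & forall t, 0 <= t <= l -> c t = pt (g *m flow t).
Proof.
move=> l0 cP; have inI t : 0 <= t <= l -> t \in (`[0, l]%classic : set R).
  by move=> tl; rewrite inE /= in_itv.
have [g0 dg0 g0E] := pt_surj (c 0); have [h dh hE] := pt_surj (c l).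
have dist A B t : \det A = 1 -> \det B = 1 -> hdist (pt A) (pt B) = t ->
    fro (invmx A *m B) = expR t + expR (- t).
  move=> dA dB; rewrite hdist_pt // => /arcosh_eq <-; first by field.
  have := fro_ge2 (det_mulmx1 (det_invmx1 dA) dB); lra.
have k0 : fro (invmx g0 *m h) = expR l + expR (- l).
  apply: dist => //; rewrite g0E hE cP ?inI ?lexx ?(ltW l0) //.
  by rewrite sub0r normrN gtr0_norm.
have dk0 := det_mulmx1 (det_invmx1 dg0) dh.
have [r [dr r1 rk]] := pt_polar dk0 l0 k0.
have dg := det_mulmx1 dg0 dr; have dgl := det_mulmx1 dg (det_flow l).
have d1 : \det (1%:M : 'M[R]_2) = 1 by rewrite det1.
have E0 : pt (g0 *m r) = c 0 by rewrite (pt_mull dg0 dr d1 r1) mulmx1.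
have El : pt (g0 *m r *m flow l) = c l.
  rewrite -mulmxA (pt_mull dg0 (det_mulmx1 dr (det_flow l)) dk0 rk).
  by rewrite mulmxA mulmxV ?unit_det1 // mul1mx.
exists (g0 *m r) => // t tl; set g := g0 *m r in dg dgl E0 El *.
have [k dk kE] := pt_surj (c t).
have dgk := det_mulmx1 (det_invmx1 dg) dk.
rewrite -kE -[k](mulKVmx (unit_det1 dg)) (pt_mull dg dgk (det_flow t)) //.
have /andP[t0 tl'] := tl.
apply: (pt_flow_uniq dgk l0).
  apply: dist => //; rewrite E0 kE cP ?inI ?lexx ?(ltW l0) //.
  by rewrite sub0r normrN ger0_norm.
rewrite -invmx_flow mulmxA -invmxM1 ?det_flow // -[t - l]opprB.
apply: dist => //; rewrite El kE cP ?inI ?lexx ?(ltW l0) //.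
by rewrite ger0_norm // subr_ge0.
Qed.

End Lines.

(** * Compactness of the surface brings every frame into a bounded set *)

Lemma compact_exhaustion (T : topologicalType) (K : set T) (U : nat -> set T) :
  compact K -> (forall n, open (U n)) ->
  (forall m n, (m <= n)%N -> U m `<=` U n) ->
  (forall x, K x -> exists n, U n x) -> exists n, K `<=` U n.
Proof.
move=> /compact_near_coveringP cK oU mU KU.
suff : \forall n \near \oo, K `<=` U n by case=> n _ h; exists n; apply: h => /=.
apply: cK => x /KU[n Unx].
exists (U n, [set m | (n <= m)%N]).
  by split => /=; [exact: open_nbhs_nbhs | exists n].
by move=> [y m] /= [Uny nm]; apply: mU Uny.
Qed.

Section Cocompact.
Variables (R : realType) (X : hyp_surface R).
Implicit Types (A B g h k : 'M[R]_2) (x y : R).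

Lemma surface_projP (z w : uhp R) :
  surface_proj X z = surface_proj X w <->
  exists2 A, deck X A & (w : R[i]) = moebius A z.
Proof.
by split=> [/(@eqquotP _ (orbit_equiv X))/asboolP|H];
  [|apply/(@eqquotP _ (orbit_equiv X))/asboolP].
Qed.

Lemma surface_proj_deck A g : deck X A -> \det g = 1 ->
  surface_proj X (pt (A *m g)) = surface_proj X (pt g).
Proof.
move=> XA dg; symmetry; apply/surface_projP; exists A => //.
by rewrite moebius_pt // (deck_det XA).
Qed.

(** For y0 > 0 this describes the points whose distance to x0 + i y0 has hyperbolic cosine less than
    1 + k / (2 y0). *)
Lemma open_uhp_disk (x0 y0 k : R) : open [set z : uhp R |
  (complex.Re z - x0) ^+ 2 + (complex.Im z - y0) ^+ 2 < k * complex.Im z].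
Proof.
pose f (p : R * R) := k * p.2 - ((p.1 - x0) * (p.1 - x0) + (p.2 - y0) * (p.2 - y0)).
have cf : continuous f.
  move=> p; apply: cvgB; first by apply: cvgM; [exact: cvg_cst|exact: cvg_snd].
  have c1 : (fun q : R * R => q.1 - x0) @ p --> p.1 - x0.
    by apply: cvgB; [exact: cvg_fst|exact: cvg_cst].
  have c2 : (fun q : R * R => q.2 - y0) @ p --> p.2 - y0.
    by apply: cvgB; [exact: cvg_snd|exact: cvg_cst].
  by apply: cvgD; apply: cvgM.
have -> : [set z : uhp R |
    (complex.Re z - x0) ^+ 2 + (complex.Im z - y0) ^+ 2 < k * complex.Im z] =
    (@uhp_coord R) @^-1` (f @^-1` [set r | 0 < r]).
  by apply/seteqP; split => z /=; rewrite /f subr_gt0 -!expr2.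
apply: open_comp; first by move=> z _; exact: initial_continuous.
by apply: open_comp; [move=> p _; exact: cf | exact: open_gt].
Qed.

Lemma cocompact : compact [set: points X] ->
  exists2 M : R, 2 <= M & forall g, \det g = 1 ->
    exists2 A, deck X A & fro (A *m g) <= M.
Proof.
move=> cX; pose U (n : nat) : set (points X) := [set p |
  exists2 A : 'M[R]_2, \det A = 1 /\ fro A < n%:R & surface_proj X (pt A) = p].
have [n Un] : exists n, [set: points X] `<=` U n.
  apply: compact_exhaustion => //; last 2 first.
  - move=> m n mn p [A [dA Am] Ap]; exists A => //; split => //.
    by apply: lt_le_trans Am _; rewrite ler_nat.
  - move=> p _; have [A dA Ap] := pt_surj (repr p); exists (Num.trunc (fro A)).+1.
    exists A; first by split => //; rewrite truncnS_gt.
    by rewrite Ap /surface_proj reprK.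
  move=> n; suff : open (surface_proj X @^-1` U n) by [].
  (* The preimage consists of the points whose distance to the deck orbit of i has hyperbolic cosine
     less than n / 2. *)
  have -> : surface_proj X @^-1` U n = \bigcup_(A in deck X)
      [set z : uhp R | (complex.Re z - complex.Re (pt A)) ^+ 2 +
        (complex.Im z - complex.Im (pt A)) ^+ 2 <
        (n%:R - 2) * complex.Im (pt A) * complex.Im z].
    have im0 (z : uhp R) : 0 < complex.Im z by case: z.
    have key A B : \det A = 1 -> \det B = 1 ->
      ((complex.Re (pt B) - complex.Re (pt A)) ^+ 2 +
        (complex.Im (pt B) - complex.Im (pt A)) ^+ 2 <
        (n%:R - 2) * complex.Im (pt A) * complex.Im (pt B)) =
      (fro (invmx A *m B) < n%:R).
      move=> dA dB; have [a0 b0] := (im0 (pt A), im0 (pt B)).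
      rewrite -[X in _ = (X < _)](@divfK _ 2) // -fro_pt //.
      set x1 := complex.Re (pt A); set x2 := complex.Re (pt B).
      move: a0 b0; set y1 := complex.Im (pt A); set y2 := complex.Im (pt B).
      move=> a0 b0; rewrite -[RHS](ltr_pM2r (mulr_gt0 a0 b0)) -[LHS]subr_gt0.
      rewrite -[RHS]subr_gt0; congr (0 < _); field.
      by rewrite !gt_eqF.
    apply/seteqP; split => [z|z [A XA]].
      move=> [A [dA An]] /surface_projP[B XB zE]; exists B => //=.
      have dB := deck_det XB.
      have -> : z = pt (B *m A) by apply: val_inj; rewrite /= zE moebius_pt.
      by rewrite key ?det_mulmx1 // (mulKmx (unit_det1 dB)).
    have dA := deck_det XA; have [B dB <-] := pt_surj z.
    rewrite /= key // => lt; exists (invmx A *m B).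
      by split => //; rewrite det_mulmx1 ?det_invmx1.
    by rewrite surface_proj_deck //; exact: deck_inv.
  by apply: bigcup_open => A _; exact: open_uhp_disk.
(* The summand 2 secures [2 <= M]. *)
exists (n%:R + 2); first by rewrite lerDr.
move=> g dg; have [A [dA An]] := Un (surface_proj X (pt g)) I.
move=> /esym/surface_projP[B XB E]; exists B => //.
have dB := deck_det XB.
have AE : pt A = pt (B *m g) by apply: val_inj; rewrite /= E moebius_pt.
have dBg := det_mulmx1 dB dg.
have d1 : \det (1%:M : 'M[R]_2) = 1 by rewrite det1.
have := fro_pt d1 dA; have := fro_pt d1 dBg; rewrite AE invmx1 !mul1mx => -> EE.
lra.
Qed.

End Cocompact.

(** * The deck group fixes no line of R^2 *)

Lemma exp_unbounded (R : realType) (a K : R) : 1 < a -> exists n, K < a ^+ n.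
Proof.
move=> a1; have H n : 1 + (a - 1) * n%:R <= a ^+ n.
  elim: n => [|n IHn]; first by rewrite mulr0 addr0 expr0.
  rewrite exprS; apply: (@le_trans _ _ (a * (1 + (a - 1) * n%:R))).
    have n0 : 0 <= n%:R :> R by [].
    by rewrite -natr1; have := mulr_ge0 (sqr_ge0 (a - 1)) n0; lra.
  by rewrite ler_pM2l //; lra.
exists (Num.trunc (K / (a - 1))).+1; apply: lt_le_trans (H _).
have a0 : 0 < a - 1 by lra.
have := truncnS_gt (K / (a - 1)); rewrite ltr_pdivrMr // mulrC; lra.
Qed.

Section NoFixedLine.
Variables (R : realType) (X : hyp_surface R).
Implicit Types (A B g h k : 'M[R]_2) (x y : R).

Let cj g A := invmx g *m A *m g.

Let cjM g A B : \det g = 1 -> cj g (A *m B) = cj g A *m cj g B.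
Proof. by move=> dg; rewrite /cj !mulmxA mulmxK ?unit_det1. Qed.

Let det_cj g A : \det g = 1 -> deck X A -> \det (cj g A) = 1.
Proof.
by move=> dg XA; rewrite !det_mulmx1 ?det_invmx1 ?(deck_det XA).
Qed.

Let cjV g A : \det g = 1 -> deck X A -> cj g (invmx A) = invmx (cj g A).
Proof.
move=> dg XA; symmetry; apply: mulmxV1; first exact: det_cj.
by rewrite -cjM // mulmxV ?unit_det1 ?(deck_det XA) // /cj mulmx1 mulVmx ?unit_det1.
Qed.

Let dgX g A (a : R) : \det g = 1 -> deck X A -> a != 0 -> cj g A = dg a ->
  forall n, exists2 B, deck X B & cj g B = dg (a ^+ n).
Proof.
move=> detg XA a0 E; elim=> [|n [B XB BE]].
  by exists 1%:M; [exact: deck_1 | rewrite expr0 dg1 /cj mulmx1 mulVmx ?unit_det1].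
exists (A *m B); first exact: deck_mul.
by rewrite cjM // E BE dgM ?unitfE ?expf_neq0 // exprS.
Qed.

(** For large n the elements A tend to the identity, since the entries of A - 1 are x / n times
    products of two entries of [g]. Discreteness makes one of them equal to the identity, so its
    entry x / n vanishes. *)
Lemma deck_unipotent g x : \det g = 1 ->
  (forall K : R, exists n A, [/\ deck X A, cj g A = mx2 1 (x / n) 0 1 & K < n]) ->
  x = 0.
Proof.
move=> dg H; have /nbhs_ballP[e /= e0 He] := deck_discrete X.
have [n [A [XA AE nK]]] := H ((`|x| * fro g) / e).
have n0 : 0 < n by apply: le_lt_trans nK; rewrite divr_ge0 ?mulr_ge0 ?fro_ge0 // ltW.
have AE' : A = g *m mx2 1 (x / n) 0 1 *m invmx g.
  by rewrite -AE /cj !mulmxA mulmxV ?unit_det1 // mul1mx mulmxK ?unit_det1.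
have small : `|x / n| * fro g < e.
  rewrite normrM normfV (gtr0_norm n0) mulrAC ltr_pdivrMr //.
  by rewrite [e * _]mulrC -ltr_pdivrMr.
have A1 : A = 1%:M.
  apply: He XA; move: AE'; rewrite invmx2 // [X in X *m _ *m _](mx2_eta g).
  rewrite !mulmx2 mx2_1 !(mulr1, mulr0, addr0) => ->; move: dg small; rewrite det2 /fro.
  move: (g 0 0) (g 0 1) (g 1 0) (g 1 1) (x / n) => a b c d y dg small.
  have bd u : `|u| <= a ^+ 2 + b ^+ 2 + (c ^+ 2 + d ^+ 2) -> `|y * u| < e.
    by move=> le; apply: le_lt_trans small; rewrite normrM ler_wpM2l.
  have := sqr_ge0 (a - c); have := sqr_ge0 (a + c).
  have := sqr_ge0 a; have := sqr_ge0 b; have := sqr_ge0 c; have := sqr_ge0 d.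
  move=> a2 b2 c2 d2 h1 h2.
  have b1 : `|y * (a * c)| < e by apply: bd; rewrite ler_norml; nra.
  have b3 : `|y * a ^+ 2| < e by apply: bd; rewrite ler_norml; nra.
  have b4 : `|y * c ^+ 2| < e by apply: bd; rewrite ler_norml; nra.
  have J (k : 'I_2) : k = 0 \/ k = 1.
    by case: k => [[|[|//]] ?]; [left|right]; apply: val_inj.
  split=> // i j; rewrite /ball /=.
  have [->|->] := J i; have [->|->] := J j; rewrite !mx2E.
  - by apply: le_lt_trans b1; rewrite le_eqVlt;
      apply/orP; left; apply/eqP; congr `|_|; rewrite -dg; ring.
  - by rewrite distrC; apply: le_lt_trans b3; rewrite le_eqVlt;
      apply/orP; left; apply/eqP; congr `|_|; ring.
  - by apply: le_lt_trans b4; rewrite le_eqVlt;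
      apply/orP; left; apply/eqP; congr `|_|; ring.
  - by rewrite distrC; apply: le_lt_trans b1; rewrite le_eqVlt;
      apply/orP; left; apply/eqP; congr `|_|; rewrite -dg; ring.
have := AE; rewrite A1 /cj mulmx1 mulVmx ?unit_det1 // mx2_1.
move/matrixP/(_ 0 1); rewrite !mx2E => /esym/eqP.
by rewrite mulf_eq0 invr_eq0 (gt_eqF n0) orbF => /eqP.
Qed.

(** The entry vanishes exactly when A preserves the line of the first column of [g]. If all of the
    group did, it would be triangular in the basis [g]. With diagonals of absolute value 1 it cannot
    be cocompact. Otherwise some A0 is hyperbolic, and conjugating commutators by powers of A0 gives
    arbitrarily small unipotents, so that discreteness makes the group diagonal, which again
    excludes cocompactness. *)
Lemma no_fixed_line g : compact [set: points X] -> \det g = 1 ->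
  exists2 A, deck X A & (invmx g *m A *m g) 1 0 != 0.
Proof.
move=> cX dg1; apply: contrapT => noA.
have T10 A : deck X A -> cj g A 1 0 = 0.
  by move=> XA; apply/eqP/negPn/negP => h; apply: noA; exists A.
clear noA; have [M M2 cM] := cocompact cX.
have bnd f : \det f = 1 -> exists2 M' : R, 0 < M' &
    forall h, \det h = 1 -> exists2 A, deck X A & fro (cj f A *m h) <= M'.
  move=> df; exists (fro (invmx f) * M).
    by rewrite mulr_gt0 //; [have := fro_ge2 (det_invmx1 df)|]; lra.
  move=> h dh; have [A XA AM] := cM _ (det_mulmx1 df dh); exists A => //.
  rewrite /cj -!mulmxA; apply: le_trans (fro_mul _ _) _.
  by rewrite ler_wpM2l ?fro_ge0.
have T11 A : deck X A -> cj g A 0 0 * cj g A 1 1 = 1.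
  by move=> XA; have := det_cj dg1 XA; rewrite det2 T10 // mulr0 subr0.
have [[A0 XA0 a1]|all1] := pselect (exists2 A, deck X A & 1 < cj g A 0 0 ^+ 2);
    last first.
  have sq1 A : deck X A -> cj g A 1 1 ^+ 2 = 1.
    move=> XA; have XV := deck_inv XA.
    have h1 : cj g A 0 0 ^+ 2 <= 1.
      by rewrite leNgt; apply/negP => lt; apply: all1; exists A.
    have h2 : cj g A 1 1 ^+ 2 <= 1.
      rewrite leNgt; apply/negP => lt; apply: all1; exists (invmx A) => //.
      by rewrite cjV // invmx2 ?det_cj // mx2E.
    have := congr1 (fun z => z ^+ 2) (T11 _ XA); rewrite /= exprMn expr1n.
    have := sqr_ge0 (cj g A 0 0); nra.
  (* All diagonal entries have square 1, so the group cannot shrink the lower right entry M' + 1 of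
     the frame diag(1 / (M' + 1), M' + 1). *)
  have [M' M'0 cM'] := bnd _ dg1.
  have e0 : 0 < (M' + 1)^-1 by rewrite invr_gt0; lra.
  have [A XA] := cM' _ (det_dg (unit_gt0 e0)).
  rewrite [cj g A]mx2_eta mulmx2 /fro !mx2E !invrK !mulr0 !addr0 !add0r T10 // !mul0r.
  rewrite !exprMn sq1 // mul1r; have := sqr_ge0 (cj g A 0 1 * (M' + 1)).
  rewrite exprMn => h1 h2; have := sqr_ge0 (cj g A 0 0 * (M' + 1)^-1).
  rewrite exprMn; nra.
have [p pE] : exists p, p = cj g A0 0 0 by exists (cj g A0 0 0).
have p0 : p != 0 by apply: contraTneq a1; rewrite -pE => ->; rewrite expr0n /= ltr10.
have p2 : 1 < p ^+ 2 by rewrite pE.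
have r0 : p - p^-1 != 0.
  apply: contraTneq p2 => /eqP; rewrite subr_eq0 => /eqP pp.
  by rewrite expr2 {1}pp mulVf // ltxx.
(* Conjugation by this unipotent diagonalizes A0. *)
pose x := - cj g A0 0 1 / (p - p^-1); pose u := mx2 1 x 0 1.
have du : \det u = 1 by rewrite det_mx2; ring.
pose f := g *m u; have df : \det f = 1 by rewrite det_mulmx1.
have cjf A : cj f A = invmx u *m cj g A *m u.
  by rewrite /cj /f invmxM1 // !mulmxA.
have F10 A : deck X A -> cj f A 1 0 = 0.
  move=> XA; rewrite cjf invmx2 // [cj g A]mx2_eta !mulmx2 !mx2E T10 //; ring.
have fA0 : cj f A0 = dg p.
  rewrite cjf invmx2 // [cj g A0]mx2_eta T10 // -pE.
  have -> : cj g A0 1 1 = p^-1.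
    by apply: (mulfI p0); rewrite mulfV // pE T11.
  have n1 : p * p - 1 != 0 by rewrite gt_eqF // subr_gt0 -expr2.
  by rewrite /u !mx2E !mulmx2 /x /dg; congr mx2; field; rewrite ?p0 ?n1.
have F01 A : deck X A -> cj f A 0 1 = 0.
  move=> XA; set a := cj f A 0 0; set q := cj f A 0 1; set d := cj f A 1 1.
  have ad : a * d = 1 by have := det_cj df XA; rewrite det2 F10 // mulr0 subr0.
  have a0 : a != 0.
    apply/eqP => a0; move: ad.
    by rewrite a0 mul0r => /esym/eqP; rewrite oner_eq0.
  have dE : d = a^-1 by apply: (mulfI a0); rewrite mulfV.
  have fA : cj f A = mx2 a q 0 a^-1 by rewrite [LHS]mx2_eta F10 // -dE.
  have XV0 := deck_inv XA0; have XV := deck_inv XA.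
  (* The diagonal parts cancel in a commutator, which is therefore unipotent; its upper right entry
     vanishes only if q does. *)
  pose C := A *m invmx A0 *m invmx A *m A0.
  have XC : deck X C by rewrite /C; do 3! [apply: deck_mul => //].
  have fC : cj f C = mx2 1 (a * q * (1 - p ^- 2)) 0 1.
    rewrite /C !cjM // !cjV // fA fA0 !invmx2 ?det_mx2 ?mx2E; first last.
    - by rewrite mulr0 subr0 mulfV.
    - by rewrite mulr0 subr0 mulfV.
    by rewrite !mulmx2; congr mx2; field; rewrite ?a0 ?p0.
  have : a * q * (1 - p ^- 2) = 0.
    apply: (deck_unipotent df) => K; have [n nK] := exp_unbounded K p2.
    have [B XB BE] := dgX df XA0 p0 fA0 n; exists ((p ^+ 2) ^+ n).
    have XVB := deck_inv XB; have pn : p ^+ n != 0 by rewrite expf_neq0.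
    (* Conjugation by the n-th power of A0 divides the upper right entry by p^(2n). *)
    exists (invmx B *m C *m B); split => //; first by do 2! [apply: deck_mul => //].
    rewrite (cjM _ B) // (cjM _ C) // cjV // BE fC.
    rewrite invmx2 ?det_mx2 ?mx2E; last by rewrite mulr0 subr0 mulfV.
    rewrite !mulmx2 -exprM mulnC exprM; move: (p ^+ n) pn => P pn.
    by congr mx2; field; rewrite ?pn ?p0.
  move/eqP; rewrite !mulf_eq0 (negPf a0) /= => /orP[/eqP//|].
  rewrite subr_eq0 => /eqP h; move: p2; rewrite -[p ^+ 2]invrK -h invr1 ltxx //.
have [M' M'0 cM'] := bnd _ df.
(* A diagonal matrix diag(a, d) with ad = 1 cannot bound this frame: a (M' + 1) and d would both
   have squares at most M', while their product is M' + 1. *)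
have dh : \det (mx2 1 (M' + 1) 0 1) = 1 :> R by rewrite det_mx2; ring.
have [A XA] := cM' _ dh.
have := det_cj df XA; rewrite det2 F01 // F10 // mul0r subr0.
rewrite [cj f A]mx2_eta mulmx2 /fro !mx2E F01 // F10 //.
rewrite !mulr0 !mul0r !addr0 !mulr1 !add0r.
move: (cj f A 0 0) (cj f A 1 1) => a d ad; rewrite exprMn expr0n /= add0r => h.
have h1 : a ^+ 2 * d ^+ 2 = 1 by rewrite -exprMn ad expr1n.
have a2 := sqr_ge0 a; have d2 := sqr_ge0 d.
have ha : a ^+ 2 * (M' + 1) ^+ 2 <= M' by lra.
have hd : d ^+ 2 <= M' by have := mulr_ge0 a2 (sqr_ge0 (M' + 1)); lra.
have : a ^+ 2 * (M' + 1) ^+ 2 * d ^+ 2 <= M' * M'.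
  by apply: ler_pM => //; rewrite mulr_ge0 ?sqr_ge0.
rewrite mulrAC h1 mul1r; nra.
Qed.

End NoFixedLine.

(** * Bounded deck elements make any two lines transverse *)

Section Transversality.
Variables (R : realType) (X : hyp_surface R).
Implicit Types (A B g h k : 'M[R]_2) (x y s t : R) (u v p : R * R).

Definition form h u v : R :=
  u.1 * (h 0 0 * v.1 + h 0 1 * v.2) + u.2 * (h 1 0 * v.1 + h 1 1 * v.2).

(** Two affine charts of the projective line; with parameters in [-1, 1] they cover it by compact
    segments. *)
Definition chart (w : bool) s : R * R := if w then (1, s) else (s, 1).

Lemma chartP u : exists w s r, [/\ -1 <= s <= 1,
  u = (r * (chart w s).1, r * (chart w s).2) & u.1 ^+ 2 + u.2 ^+ 2 <= 2 * r ^+ 2].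
Proof.
have bd x y : `|y| <= `|x| -> -1 <= y / x <= 1.
  move=> yx; rewrite -ler_norml normrM normfV.
  have [->|x0] := eqVneq x 0; first by rewrite normr0 invr0 mulr0.
  by rewrite ler_pdivrMr ?normr_gt0 // mul1r.
have ml x y : `|y| <= `|x| -> x * (y / x) = y.
  move=> yx; have [x0|x0] := eqVneq x 0; last by rewrite mulrC divfK.
  by move: yx; rewrite x0 normr0 normr_le0 => /eqP ->; rewrite mul0r.
have sq x y : `|y| <= `|x| -> y ^+ 2 <= x ^+ 2.
  move=> yx; rewrite -(real_normK (num_real y)) -(real_normK (num_real x)).
  by rewrite lerXn2r ?nnegrE.
case: u => x y; case: (leP `|y| `|x|) => [yx|/ltW xy].
  exists true, (y / x), x; rewrite bd //= ml // mulr1; split => //.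
  by have := sq _ _ yx; lra.
exists false, (x / y), y; rewrite bd //= ml // mulr1; split => //.
by have := sq _ _ xy; lra.
Qed.

Hypothesis X_compact : compact [set: points X].

(** If u and v are not orthogonal, the identity serves. Otherwise u is a multiple of v turned by a
    right angle, and the form is that multiple of the lower left entry of g^-1 h g, where v is the
    first column of [g]. *)
Lemma form_neq0 u v : u.1 ^+ 2 + u.2 ^+ 2 != 0 -> v.1 ^+ 2 + v.2 ^+ 2 != 0 ->
  exists2 h, deck X h & form h u v != 0.
Proof.
case: u v => [x y] [a c] /= u0 v0.
have [uv|uv] := eqVneq (x * a + y * c) 0; last first.
  exists 1%:M; first exact: deck_1.
  by rewrite mx2_1 /form !mx2E /=; move: uv; apply: contra_neq => <-; ring.
pose N := a ^+ 2 + c ^+ 2; pose g := mx2 a (- c / N) c (a / N).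
have dg : \det g = 1 by rewrite det_mx2 /N; field.
have [A XA A0] := no_fixed_line X_compact dg; exists A => //.
pose m := (y * a - x * c) / N.
have mN : m * N = y * a - x * c by rewrite /m divfK.
have xE : x = - m * c.
  apply: (mulIf v0); transitivity (- c * (m * N)); last by rewrite /N; ring.
  by rewrite mN; have := congr1 (fun z => a * z) uv; rewrite /= mulr0; lra.
have yE : y = m * a.
  apply: (mulIf v0); transitivity (a * (m * N)); last by rewrite /N; ring.
  by rewrite mN; have := congr1 (fun z => c * z) uv; rewrite /= mulr0; lra.
have m0 : m != 0.
  by apply: contraNneq u0 => m0; rewrite xE yE m0; apply/eqP; ring.
move: A0; apply: contra_neq; rewrite /form /= xE yE => E.
apply: (mulfI m0); rewrite mulr0 -E invmx2 // !mulmx2E !mx2E; ring.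
Qed.

Let chart_form (w w' : bool) : exists n : nat, forall s t,
  -1 <= s <= 1 -> -1 <= t <= 1 ->
  exists h, [/\ deck X h, fro h < n%:R &
    1 < n%:R * form h (chart w s) (chart w' t) ^+ 2].
Proof.
pose f h (p : R * R) := form h (chart w p.1) (chart w' p.2).
pose U (n : nat) : set (R * R) := [set p | exists h,
  [/\ deck X h, fro h < n%:R & 1 < n%:R * f h p ^+ 2]].
have [n Un] : exists n, `[-1, 1]%classic `*` `[-1, 1]%classic `<=` U n.
  apply: compact_exhaustion.
  - by apply: compact_setX; exact: segment_compact.
  - move=> n; have -> : U n = \bigcup_(h in [set h | deck X h /\ fro h < n%:R])
        ((fun p => n%:R * (f h p * f h p)) @^-1` [set r | 1 < r]).
      apply/seteqP; split => p /=.
        by move=> [h [Xh hn hp]]; exists h => //=; rewrite -expr2.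
      by move=> [h [Xh hn hp]]; exists h; split => //; rewrite expr2.
    apply: bigcup_open => h _; apply: open_comp; last exact: open_gt.
    have c1 (b : bool) (F : R * R -> R) : continuous F ->
        continuous (fun p => (chart b (F p)).1).
      by move=> cF; case: b => //= p; exact: cvg_cst.
    have c2 (b : bool) (F : R * R -> R) : continuous F ->
        continuous (fun p => (chart b (F p)).2).
      by move=> cF; case: b => //= p; exact: cvg_cst.
    have cf : continuous (f h).
      move=> p; have fc : continuous (@fst R R) by move=> q; exact: cvg_fst.
      have sc : continuous (@snd R R) by move=> q; exact: cvg_snd.
      apply: cvgD; (apply: cvgM; first by [apply: c1|apply: c2]).
        by apply: cvgD; apply: cvgM; first [exact: cvg_cst|exact: c1|exact: c2].
      by apply: cvgD; apply: cvgM; first [exact: cvg_cst|exact: c1|exact: c2].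
    move=> p _; apply: cvgM; first exact: cvg_cst.
    by apply: cvgM; exact: cf.
  - move=> m n mn p [h [Xh hm hp]]; exists h; split => //.
      by apply: lt_le_trans hm _; rewrite ler_nat.
    by apply: lt_le_trans hp _; rewrite ler_wpM2r ?sqr_ge0 // ler_nat.
  - move=> p _; have ch0 b s : (chart b s).1 ^+ 2 + (chart b s).2 ^+ 2 != 0.
      by case: b => /=; have := sqr_ge0 s; rewrite expr1n => ?; lra.
    have [h Xh h0] := form_neq0 (ch0 w p.1) (ch0 w' p.2).
    have F0 : 0 < f h p ^+ 2 by rewrite exprn_even_gt0.
    exists (maxn (Num.trunc (fro h)).+1 (Num.trunc (f h p ^- 2)).+1), h.
    split => //.
      by apply: lt_le_trans (truncnS_gt _) _; rewrite ler_nat leq_maxl.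
    rewrite -ltr_pdivrMr // mul1r.
    by apply: lt_le_trans (truncnS_gt _) _; rewrite ler_nat leq_maxr.
exists n => s t hs ht; by apply: (Un (s, t)); split; rewrite /= in_itv.
Qed.

Lemma transversality : exists2 n : R, 0 < n & forall u v, exists h,
  [/\ deck X h, fro h <= n &
    (u.1 ^+ 2 + u.2 ^+ 2) * (v.1 ^+ 2 + v.2 ^+ 2) <= n * form h u v ^+ 2].
Proof.
have [n1 h1] := chart_form true true; have [n2 h2] := chart_form true false.
have [n3 h3] := chart_form false true; have [n4 h4] := chart_form false false.
pose n := (n1 + n2 + n3 + n4).+1.
have H w w' s t : -1 <= s <= 1 -> -1 <= t <= 1 ->
    exists h, [/\ deck X h, fro h <= n%:R &
    1 <= n%:R * form h (chart w s) (chart w' t) ^+ 2].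
  move=> hs ht; suff [m [mn [h [Xh hm hf]]]] : exists m, (m <= n)%N /\ exists h,
      [/\ deck X h, fro h < m%:R &
      1 < m%:R * form h (chart w s) (chart w' t) ^+ 2].
    exists h; split => //.
      by apply: ltW; apply: lt_le_trans hm _; rewrite ler_nat.
    apply: ltW; apply: lt_le_trans hf _.
    by rewrite ler_wpM2r ?sqr_ge0 // ler_nat.
  case: w; case: w'.
  - by exists n1; split; [rewrite /n; lia | exact: h1].
  - by exists n2; split; [rewrite /n; lia | exact: h2].
  - by exists n3; split; [rewrite /n; lia | exact: h3].
  - by exists n4; split; [rewrite /n; lia | exact: h4].
(* The estimate on the charts extends by homogeneity; the factor 4 is the product of the two factors
   2 in [chartP]. *)
exists (4 * n%:R); first by rewrite mulr_gt0 // ltr0n.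
move=> u v; have [w [s [r [hs -> ur]]]] := chartP u.
have [w' [t [q [ht -> vq]]]] := chartP v.
have [h [Xh hn hf]] := H w w' s t hs ht; exists h; split => //.
  by have : 0 <= n%:R :> R by []; lra.
move: ur vq => /=; set a := chart w s in hf *; set b := chart w' t in hf *.
have -> : form h (r * a.1, r * a.2) (q * b.1, q * b.2) = r * q * form h a b.
  by rewrite /form /=; ring.
rewrite !exprMn => ur vq; apply: (@le_trans _ _ ((2 * r ^+ 2) * (2 * q ^+ 2))).
  by apply: ler_pM => //; rewrite addr_ge0 // mulr_ge0 ?sqr_ge0.
have rq : 0 <= r ^+ 2 * q ^+ 2 by rewrite mulr_ge0 ?sqr_ge0.
have := ler_wpM2l rq hf; lra.
Qed.


End Transversality.

(** * Matrices contracting cones, and their axes *)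

Section Cones.
Variable R : realType.
Implicit Types (A Q G W : 'M[R]_2) (x y u v k B lam : R).

(* [Q] preserves slopes at most [k], [Q^-1] preserves inverse slopes at most
   [k]; [n] counts the factors of a product of such matrices. *)
Definition cone k B (n : nat) Q : Prop :=
  [/\ \det Q = 1,
      forall x y, `|y| <= k * `|x| ->
        [/\ `|Q 1 0 * x + Q 1 1 * y| <= k * `|Q 0 0 * x + Q 0 1 * y|,
            2 ^+ n * `|x| <= `|Q 0 0 * x + Q 0 1 * y| &
            `|Q 0 0 * x + Q 0 1 * y| <= B ^+ n * `|x|] &
      forall x y, `|x| <= k * `|y| ->
        `|Q 1 1 * x - Q 0 1 * y| <= k * `|Q 0 0 * y - Q 1 0 * x|].

Lemma cone1 k B : cone k B 0 1%:M.
Proof.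
rewrite mx2_1; split; first by rewrite det_mx2; ring.
  by move=> x y yx; rewrite !mx2E !mul1r !mul0r !addr0 add0r ?expr0 ?mul1r.
by move=> x y yx; rewrite !mx2E !mul1r !mul0r !subr0.
Qed.

Lemma coneM k B m n Q Q' : 0 <= B -> cone k B m Q -> cone k B n Q' ->
  cone k B (m + n) (Q *m Q').
Proof.
move=> B0 [dQ fQ bQ] [dQ' fQ' bQ']; split; first exact: det_mulmx1.
  move=> x y /fQ'[h1 h2 h3]; have [h4 h5 h6] := fQ _ _ h1.
  rewrite !mulmx2E.
  have E (a b : R) : a * (Q' 0 0 * x + Q' 0 1 * y) + b * (Q' 1 0 * x + Q' 1 1 * y)
    = (a * Q' 0 0 + b * Q' 1 0) * x + (a * Q' 0 1 + b * Q' 1 1) * y by ring.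
  rewrite -!E; split => //.
    by apply: le_trans h5; rewrite exprD -mulrA ler_wpM2l // exprn_ge0.
  by apply: le_trans h6 _; rewrite exprD -mulrA ler_wpM2l // exprn_ge0.
move=> x y /bQ h; have := bQ' _ _ h; rewrite !mulmx2E.
set l := (X in `|X| <= _ -> _); set r := (X in _ <= k * `|X| -> _) => lr.
by congr (_ <= k * _): lr; congr `|_|; rewrite /l /r; ring.
Qed.

(** In dg E A dg E the upper left entry, at least c E^2, dominates. On the cone the first coordinate
    of the image is at least (c E^2 - b) |x| and the second at most 2 b |x|. The value of k gives k
    (c E^2 - b) = 3 b - k b >= 2 b, and the lower bound on E^2 gives the expansion c E^2 - b >=
    2. *)
Lemma cone_sandwich k b c E (A : 'M[R]_2) : \det A = 1 ->
  (forall i j, `|A i j| <= b) -> 0 < c -> c <= `|A 0 0| -> 1 <= b ->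
  k = 3 * b / c / E ^+ 2 -> k <= 1 -> 1 <= E -> (b + 2) / c <= E ^+ 2 ->
  cone k (2 * b * E ^+ 2) 1 (dg E *m A *m dg E).
Proof.
move=> dA Ab c0 cA b1 kE k1 E1 E2; have E0 : 0 < E by lra.
have E20 : 0 < E ^+ 2 by rewrite exprn_gt0.
have E21 : 1 <= E ^+ 2 by rewrite exprn_ege1.
have k0 : 0 < k by rewrite kE !divr_gt0 // mulr_gt0 //; lra.
have kcE : k * (c * E ^+ 2) = 3 * b by rewrite kE; field; rewrite !gt_eqF.
move: E2; rewrite ler_pdivrMr // => E2.
have IE0 : 0 < E ^- 2 by rewrite invr_gt0.
have IE1 : E ^- 2 <= 1 by rewrite invf_le1.
have -> : dg E *m A *m dg E = mx2 (A 0 0 * E ^+ 2) (A 0 1) (A 1 0) (A 1 1 * E ^- 2).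
  rewrite [A in LHS]mx2_eta /dg !mulmx2; by by congr mx2; field; rewrite ?gt_eqF.
have A00 := Ab 0 0; have A01 := Ab 0 1; have A10 := Ab 1 0; have A11 := Ab 1 1.
(* The entries are left general because the condition on the inverse is the same estimate with the
   off-diagonal entries exchanged and negated. *)
have main x y : `|y| <= k * `|x| -> forall p q r s, `|p| <= b -> `|q| <= b ->
    `|r| <= b -> `|s| <= b -> c <= `|p| ->
    [/\ `|r * x + s * E ^- 2 * y| <= k * `|p * E ^+ 2 * x + q * y|,
      2 * `|x| <= `|p * E ^+ 2 * x + q * y| &
      `|p * E ^+ 2 * x + q * y| <= 2 * b * E ^+ 2 * `|x| ].
  move=> yx p q r s pb qb rb sb cp.
  have X0 := normr_ge0 x; have Y0 := normr_ge0 y.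
  have yx1 : `|y| <= `|x| by apply: le_trans yx _; rewrite ler_piMl.
  have bx : 0 <= b * `|x| by rewrite mulr_ge0 //; lra.
  have qy : `|q * y| <= b * (k * `|x|) by rewrite normrM ler_pM.
  have qy' : b * (k * `|x|) <= b * `|x| by rewrite ler_wpM2l ?ler_piMl //; lra.
  have px : `|p * E ^+ 2 * x| = `|p| * E ^+ 2 * `|x|.
    by rewrite normrM (normrM p) (gtr0_norm E20).
  have lo : c * E ^+ 2 * `|x| - b * `|x| <= `|p * E ^+ 2 * x + q * y|.
    have := lerB_normD (p * E ^+ 2 * x) (q * y); rewrite px.
    have : c * E ^+ 2 * `|x| <= `|p| * E ^+ 2 * `|x|.
      by rewrite ler_wpM2r // ler_wpM2r // ltW.
    lra.
  split.
  - have l1 : `|r * x + s * E ^- 2 * y| <= 2 * b * `|x|.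
      apply: le_trans (ler_normD _ _) _; rewrite !normrM (gtr0_norm IE0).
      have : `|r| * `|x| <= b * `|x| by rewrite ler_wpM2r.
      have : `|s| * E ^- 2 * `|y| <= b * `|x|.
        apply: ler_pM => //; first by rewrite mulr_ge0 // ltW.
        by apply: le_trans sb; rewrite ler_piMr.
      lra.
    apply: le_trans l1 _; apply: le_trans (ler_wpM2l (ltW k0) lo).
    have -> : k * (c * E ^+ 2 * `|x| - b * `|x|) = 3 * b * `|x| - k * (b * `|x|).
      by rewrite -kcE; ring.
    have : k * (b * `|x|) <= b * `|x| by rewrite ler_piMl.
    lra.
  - apply: le_trans lo; rewrite -mulrBl ler_wpM2r //; lra.
  - apply: le_trans (ler_normD _ _) _; rewrite px.
    have : `|p| * E ^+ 2 * `|x| <= b * E ^+ 2 * `|x|.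
      by rewrite ler_wpM2r // ler_wpM2r // ltW.
    have : b * `|x| <= b * E ^+ 2 * `|x|.
      by rewrite ler_wpM2r // ler_peMr //; lra.
    lra.
split.
- by rewrite det_mx2 -dA det2; field; rewrite gt_eqF.
- by move=> x y yx; rewrite !mx2E !expr1; apply: main.
- move=> x y xy; rewrite !mx2E.
  have A10' : `|- A 1 0| <= b by rewrite normrN.
  have A01' : `|- A 0 1| <= b by rewrite normrN.
  have [h _ _] := main _ _ xy _ _ _ _ A00 A10' A01' A11 cA.
  by move: h; rewrite !mulNr [- _ + _]addrC.
Qed.

(** Intermediate value theorem on [-k, k] for u (a + b u) - (c + d u): the slope map sends the
    interval to itself, and its denominator has no zero there. *)
Lemma fixed_slope a b c d k : 0 <= k ->
  (forall y, `|y| <= k -> `|c + d * y| <= k * `|a + b * y|) -> k * `|b| < `|a| ->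
  exists2 u, `|u| <= k & c + d * u = u * (a + b * u).
Proof.
move=> k0; wlog a0 : a b c d / 0 < a.
  move=> W H ba; case: (ltrgtP 0 a) => a0; first exact: W.
    have [|||u uk E] := W (- a) (- b) (- c) (- d); rewrite ?oppr_gt0 ?normrN //.
      by move=> y yk; rewrite !mulNr -!opprD !normrN; exact: H.
    exists u => //; apply: oppr_inj; rewrite opprD -mulNr E; ring.
  by move: ba; rewrite -a0 normr0 ltNge mulr_ge0.
rewrite (gtr0_norm a0) => H ba.
have pos y : `|y| <= k -> 0 < a + b * y.
  move=> yk; have : `|b * y| <= k * `|b| by rewrite normrM mulrC ler_wpM2r.
  by rewrite ler_norml => /andP[]; lra.
have kk : `|k| <= k by rewrite ger0_norm.
have kk' : `|- k| <= k by rewrite normrN.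
pose p : {poly R} := 'X * (a%:P + b *: 'X) - (c%:P + d *: 'X).
have pE y : p.[y] = y * (a + b * y) - (c + d * y) by rewrite !hornerE.
have [||u] := @poly_ivt R p (- k) k.
- by rewrite ge0_cp.
- rewrite !pE; have := H _ kk; have := H _ kk'.
  rewrite (gtr0_norm (pos _ kk)) (gtr0_norm (pos _ kk')) !ler_norml.
  by move=> /andP[h1 h2] /andP[h3 h4]; apply/andP; split; lra.
move=> uk /rootP; rewrite pE => E.
exists u; first by rewrite ler_norml.
by apply/eqP; rewrite eq_sym -subr_eq0 E.
Qed.

(** The columns of [W] span the forward and backward endpoints of the geodesic with frame [W]; the
    conditions place them near those of the standard geodesic from 0 to infinity. *)
Definition aligned k W : Prop :=
  [/\ \det W = 1, `|W 1 0| <= k * `|W 0 0| & `|W 0 1| <= k * `|W 1 1|].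

(** The fixed slope u of Q and the fixed inverse slope v of its inverse give eigenvectors (1, u) and
    (v, 1), the columns of G up to scaling. The growth of (1, u) under Q bounds the eigenvalue on
    both sides. *)
Lemma cone_axis k B n Q : 0 <= k <= 1 / 2 -> cone k B n Q ->
  exists G lam, [/\ aligned k G, Q *m G = G *m dg lam, 2 ^+ n <= `|lam| &
    `|lam| <= B ^+ n].
Proof.
move=> /andP[k0 k1] [dQ fQ bQ].
have dQ' := dQ; rewrite det2 in dQ'.
(* Otherwise (Q01, - Q00) would lie in the cone; its image has first coordinate 0, hence would
   vanish, against det Q = 1. *)
have kb : k * `|Q 0 1| < `|Q 0 0|.
  rewrite ltNge; apply/negP => h; have := fQ (Q 0 1) (- Q 0 0).
  rewrite normrN => /(_ h)[+ _ _].
  have -> : Q 0 0 * Q 0 1 + Q 0 1 * - Q 0 0 = 0 by ring.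
  rewrite normr0 mulr0.
  rewrite normr_le0 => /eqP E; have := oner_neq0 R; rewrite -dQ'.
  by move/eqP; apply; lra.
have kc : k * `|Q 1 0| < `|Q 0 0|.
  rewrite ltNge; apply/negP => h; have := bQ (Q 0 0) (Q 1 0) h.
  rewrite [Q 1 0 * _]mulrC subrr normr0 mulr0.
  rewrite normr_le0 => /eqP E; have := oner_neq0 R; rewrite -dQ'.
  by move/eqP; apply; lra.
have [|u uk uE] := @fixed_slope (Q 0 0) (Q 0 1) (Q 1 0) (Q 1 1) k k0 _ kb.
  move=> y yk; have [] := fQ 1 y; first by rewrite normr1 mulr1.
  by rewrite !mulr1.
have [||v vk vE] := @fixed_slope (Q 0 0) (- Q 1 0) (- Q 0 1) (Q 1 1) k k0 _ _.
- move=> y yk; have := bQ y 1; rewrite normr1 !mulr1 => /(_ yk).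
  by rewrite mulNr [- _ + _]addrC.
- by rewrite normrN.
(* This makes the two eigenvectors independent, with determinant 1 - u v. *)
have uv : `|u * v| <= 1 / 4.
  have -> : 1 / 4 = (1 / 2) * (1 / 2) :> R by field.
  by rewrite normrM ler_pM // (le_trans _ k1).
have d0 : 1 - u * v != 0 by move: uv; rewrite ler_norml => /andP[]; lra.
pose lam := Q 0 0 + Q 0 1 * u; pose nu := Q 1 0 * v + Q 1 1.
have ln : lam * nu = 1.
  apply: (mulIf d0); transitivity ((Q 0 0 * Q 1 1 - Q 0 1 * Q 1 0) * (1 - u * v));
    last by rewrite dQ'.
  have e1 : Q 0 0 * v + Q 0 1 = v * nu by rewrite /nu; lra.
  transitivity (lam * nu - (v * nu) * (u * lam)); first by ring.
  by rewrite -e1 /lam -uE /nu; ring.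
have lam0 : lam != 0 by apply: contra_eq_neq ln => ->; rewrite mul0r eq_sym oner_neq0.
have nuE : nu = lam^-1 by apply: (mulfI lam0); rewrite ln mulfV.
exists (mx2 (1 - u * v)^-1 v (u / (1 - u * v)) 1), lam.
have [_ l2 lB] := fQ 1 u ltac:(by rewrite normr1 mulr1).
rewrite normr1 !mulr1 in l2 lB; split => //.
- split; first by rewrite det_mx2; field.
    by rewrite !mx2E normrM ler_wpM2r.
  by rewrite !mx2E normr1 mulr1.
rewrite [Q]mx2_eta /dg -nuE !mulmx2; congr mx2; rewrite /nu ?mulr0 ?mul0r ?addr0 ?add0r.
- by rewrite /lam; field.
- rewrite mulr1; lra.
- transitivity ((Q 1 0 + Q 1 1 * u) / (1 - u * v)); first by field.
  by rewrite uE -/lam; field.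
- by rewrite mulr1 mul1r.
Qed.

(** The first column of Q2 G is controlled by the forward cone of Q2. As Q2 G = Q1^-1 G dg lam, the
    second is controlled by the backward cone of Q1. *)
Lemma aligned_cone k B m n Q1 Q2 G lam : cone k B m Q1 -> cone k B n Q2 ->
  aligned k G -> lam != 0 -> Q1 *m Q2 *m G = G *m dg lam ->
  aligned k (Q2 *m G).
Proof.
move=> [d1 f1 b1] [d2 f2 b2] [dG g1 g2] l0 E; split; first exact: det_mulmx1.
  by rewrite !mulmx2E; have [] := f2 _ _ g1.
have -> : Q2 *m G = invmx Q1 *m G *m dg lam.
  by rewrite -[RHS]mulmxA -E -!mulmxA (mulKmx (unit_det1 d1)).
rewrite invmx2 // ![(_ *m dg _) _ _]mulmx2E ![(_ *m G) _ _]mulmx2E !mx2E.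
rewrite !mulr0 !add0r !normrM mulrA ler_wpM2r // !mulNr.
by rewrite [- _ + _]addrC; exact: b1.
Qed.

End Cones.

(** * Chaining frames by deck elements into a closed geodesic *)

Section Chains.
Variables (R : realType) (X : hyp_surface R).
Implicit Types (A Q S g h x y : 'M[R]_2) (k B E L : R).

Lemma fro_entry A i j : A i j ^+ 2 <= fro A.
Proof.
have H (l : 'I_2) : l = 0 \/ l = 1.
  by case: l => [[|[|//]] ?]; [left|right]; apply: val_inj.
have := sqr_ge0 (A 0 0); have := sqr_ge0 (A 0 1).
have := sqr_ge0 (A 1 0); have := sqr_ge0 (A 1 1).
by rewrite /fro; have [->|->] := H i; have [->|->] := H j; lra.
Qed.

Lemma fro_inv A : \det A = 1 -> fro (invmx A) = fro A.
Proof. by move=> dA; rewrite /fro invmx2 // !mx2E !sqrrN; ring. Qed.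

Hypothesis X_compact : compact [set: points X].

(* Move the far ends of both geodesics into a compact set by deck elements;
   there, a bounded deck element makes them transverse. *)
Lemma connecting_element : exists K b E0 : R, [/\ 0 < K, 1 <= b, 0 < E0 &
  forall E k, E0 <= E ^+ 2 -> 1 <= E -> k = K / E ^+ 2 -> k <= 1 ->
  forall g h, \det g = 1 -> \det h = 1 ->
  exists2 S, deck X S & cone k (2 * b * E ^+ 2) 1 (invmx g *m S *m h)].
Proof.
have [M M2 cM] := cocompact X_compact.
have [n n0 tr] := transversality X_compact.
(* [b] will bound the entries of the middle factor D, and the root of [c2] will bound |D00| from
   below, as [cone_sandwich] requires. *)
pose b := M * n * M + 1; pose c2 := (4 * M * M * n)^-1.
have M0 : 0 < M by lra.
have Mn : 0 < M * n * M by rewrite !mulr_gt0.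
have b1 : 1 <= b by rewrite /b; lra.
have c20 : 0 < c2 by rewrite invr_gt0 !mulr_gt0.
pose c := Num.sqrt c2; have c0 : 0 < c by rewrite sqrtr_gt0.
exists (3 * b / c), b, ((b + 2) / c); split => //.
- by rewrite divr_gt0 ?mulr_gt0 //; lra.
- by rewrite divr_gt0 //; lra.
move=> E k E2 E1 kE k1 g h detg deth; have E0 : 0 < E by lra.
have dgE := det_dg (unit_gt0 E0).
have IE0 : 0 < E^-1 by rewrite invr_gt0.
have dgIE := det_dg (unit_gt0 IE0).
have [A XA AM] := cM _ (det_mulmx1 detg dgE).
have [A' XA' AM'] := cM _ (det_mulmx1 deth dgIE).
have [dA dA'] := (deck_det XA, deck_det XA').
set p := A *m _ in AM; set q := A' *m _ in AM'.
have dp : \det p = 1 by rewrite /p !det_mulmx1.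
have dq : \det q = 1 by rewrite /q !det_mulmx1.
have [f [Xf fn fl]] := tr (p 1 1, - p 0 1) (q 0 0, q 1 0).
have df := deck_det Xf.
exists (invmx A *m f *m A').
  by apply: deck_mul => //; apply: deck_mul => //; exact: deck_inv.
(* Here dg E is the flow for time 2 ln E. Undoing the forward flow of g and the backward flow of h
   leaves a factor dg E on each side of D. *)
pose D := invmx p *m f *m q.
have -> : invmx g *m (invmx A *m f *m A') *m h = dg E *m D *m dg E.
  rewrite /D /p /q !invmxM1 ?det_mulmx1 // invmx_dg ?unit_gt0 // !mulmxA.
  rewrite dgM ?unit_gt0 // divff ?gt_eqF // dg1 mul1mx.
  by rewrite -!mulmxA dgM ?unit_gt0 // mulVf ?gt_eqF // dg1 mulmx1.
have dD : \det D = 1 by rewrite !det_mulmx1 ?det_invmx1.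
have froD : fro D <= M * n * M.
  apply: le_trans (fro_mul _ _) _; apply: ler_pM; rewrite ?fro_ge0 //.
  apply: le_trans (fro_mul _ _) _; apply: ler_pM; rewrite ?fro_ge0 //.
  by rewrite fro_inv.
apply: (@cone_sandwich _ k b c) => //.
- move=> i j; rewrite -[leRHS]ger0_norm; last lra.
  rewrite -ler_sqr ?nnegrE // !real_normK ?num_real //.
  apply: le_trans (fro_entry _ _ _) _; apply: le_trans froD _.
  rewrite /b; set z := M * n * M in Mn *; nra.
- have D00 : D 0 0 = form f (p 1 1, - p 0 1) (q 0 0, q 1 0).
    by rewrite /D /form invmx2 // !mulmx2E !mx2E /=; ring.
  (* By Lagrange's identity the squared lengths of the columns have product at least 1, and each is
     at most M, so each is at least 1 / M. *)
  have half A0 : \det A0 = 1 -> fro A0 <= M ->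
      1 <= M * (A0 0 0 ^+ 2 + A0 1 0 ^+ 2) /\ 1 <= M * (A0 1 1 ^+ 2 + A0 0 1 ^+ 2).
    rewrite det2 /fro; move: (A0 0 0) (A0 0 1) (A0 1 0) (A0 1 1) => u v w z dz bz.
    have lag : 1 <= (u ^+ 2 + w ^+ 2) * (z ^+ 2 + v ^+ 2).
      have := congr1 (fun r => r ^+ 2) dz; have := sqr_ge0 (u * v + w * z).
      by rewrite expr1n; lra.
    have [u2 v2 w2 z2] : [/\ 0 <= u ^+ 2, 0 <= v ^+ 2, 0 <= w ^+ 2 & 0 <= z ^+ 2].
      by rewrite !sqr_ge0.
    split; apply: le_trans lag _.
      by rewrite mulrC ler_wpM2r //; lra.
    by rewrite ler_wpM2r //; lra.
  have [_ hp] := half _ dp AM; have [hq _] := half _ dq AM'.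
  rewrite -[leLHS]gtr0_norm // -ler_sqr ?nnegrE // !real_normK ?num_real //.
  have P0 : 0 < 4 * M * M * n by rewrite !mulr_gt0.
  rewrite /c sqr_sqrtr ?(ltW c20) // -(ler_pM2r P0) /c2 mulVf ?gt_eqF //.
  move: fl; rewrite -D00 /= sqrrN => fl.
  have : 1 <= M * M * (n * D 0 0 ^+ 2).
    apply: le_trans (ler_wpM2l (mulr_ge0 (ltW M0) (ltW M0)) fl).
    rewrite mulrACA -[leLHS]mulr1; exact: ler_pM.
  have := mulr_ge0 (mulr_ge0 (mulr_ge0 (ltW M0) (ltW M0)) (ltW n0)) (sqr_ge0 (D 0 0)).
  lra.
Qed.

(** Consecutive frames are linked, the last one to h, and the links multiply to Q. At each frame x
    the product splits as Q1 Q2, with Q2 made of the links from x onwards. The choice h = g closes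
    the chain. *)
Lemma deck_chain k B : 0 <= B ->
  (forall g h, \det g = 1 -> \det h = 1 ->
    exists2 S, deck X S & cone k B 1 (invmx g *m S *m h)) ->
  forall (s : seq 'M[R]_2) g h, \det h = 1 ->
  (forall x, x \in g :: s -> \det x = 1) ->
  exists S Q, [/\ deck X S, S *m h = g *m Q, cone k B (size s).+1 Q &
    forall x, x \in g :: s -> exists S' Q1 Q2,
    [/\ deck X S', S' *m h = x *m Q2, Q = Q1 *m Q2,
        exists m, cone k B m Q1 & exists n, cone k B n Q2]].
Proof.
move=> B0 link; elim=> [|y s IHs] g h dh det_s.
  have dg : \det g = 1 by apply: det_s; rewrite inE.
  have [S XS SQ] := link g h dg dh.
  exists S, (invmx g *m S *m h); split => //.
    by rewrite !mulmxA mulmxV ?unit_det1 // mul1mx.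
  move=> x; rewrite inE => /eqP ->.
  exists S, 1%:M, (invmx g *m S *m h); split => //.
  - by rewrite !mulmxA mulmxV ?unit_det1 // mul1mx.
  - by rewrite mul1mx.
  - by exists 0%N; exact: cone1.
  - by exists 1%N.
have dg : \det g = 1 by apply: det_s; rewrite mem_head.
have dy : \det y = 1 by apply: det_s; rewrite !inE eqxx orbT.
have [|S1 [Q1 [XS1 S1E cQ1 mem1]]] := IHs y h dh.
  by move=> x xs; apply: det_s; rewrite inE xs orbT.
have [S XS SQ] := link g y dg dy; set Q := invmx g *m S *m y in SQ.
have SE : S *m y = g *m Q by rewrite !mulmxA mulmxV ?unit_det1 // mul1mx.
have E : S *m S1 *m h = g *m (Q *m Q1) by rewrite -mulmxA S1E mulmxA SE -mulmxA.
have cQ : cone k B (size (y :: s)).+1 (Q *m Q1) by rewrite -add1n; exact: coneM.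
exists (S *m S1), (Q *m Q1); split => //; first exact: deck_mul.
move=> x; rewrite inE => /orP[/eqP ->|/mem1[S' [P1 [P2 [XS' S'E PE [m cm] [n cn]]]]]].
  exists (S *m S1), 1%:M, (Q *m Q1); split => //; first exact: deck_mul.
  - by rewrite mul1mx.
  - by exists 0%N; exact: cone1.
  - by exists (size (y :: s)).+1.
exists S', (Q *m P1), P2; split => //; first by rewrite PE mulmxA.
  by exists (1 + m)%N; exact: coneM.
by exists n.
Qed.

(** For a chain closed at g, S g = g Q and Q G = G dg lam, so S translates the geodesic with frame g
    G by 2 ln |lam|. At the frame x the partial product S' gives S' g G = x Q2 G, which is aligned
    by [aligned_cone]. *)
Lemma chain_axis k B : 0 <= k <= 1 / 2 -> 1 <= B ->
  (forall g h, \det g = 1 -> \det h = 1 ->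
    exists2 S, deck X S & cone k B 1 (invmx g *m S *m h)) ->
  forall (g : 'M[R]_2) (s : seq 'M[R]_2), (forall x, x \in g :: s -> \det x = 1) ->
  exists G L, [/\ \det G = 1, 0 < L <= 2 * (size s).+1%:R * ln B,
    forall t, surface_proj X (pt (G *m flow (t + L))) =
              surface_proj X (pt (G *m flow t)) &
    forall x, x \in g :: s -> exists S W,
      [/\ deck X S, S *m G = x *m W & aligned k W]].
Proof.
move=> k01 B1 link g s det_s; have B0 : 0 <= B by lra.
have detg : \det g = 1 by apply: det_s; rewrite mem_head.
have [S [Q [XS SE cQ mem]]] := deck_chain B0 link detg det_s.
have [G [lam [aG QG l2 lB]]] := cone_axis k01 cQ.
have dG : \det G = 1 by case: aG.
have l1 : 1 < `|lam|.
  by apply: lt_le_trans l2; rewrite exprn_egt1 // ltr1n.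
have l0 : lam != 0 by rewrite -normr_gt0; lra.
have nl0 : 0 < `|lam| by lra.
have dF := det_mulmx1 detg dG.
exists (g *m G), (2 * ln `|lam|); split => //.
- rewrite mulr_gt0 ?ln_gt0 //= -mulrA ler_pM2l //.
  have -> : (size s).+1%:R * ln B = ln (B ^+ (size s).+1).
    by rewrite lnXn ?mulr_natl //; lra.
  by rewrite ler_ln ?posrE // exprn_gt0 //; lra.
- move=> t; rewrite addrC flowD -dg_flow //.
  have SG : S *m (g *m G) = g *m G *m dg lam.
    by rewrite mulmxA SE -mulmxA QG mulmxA.
  (* A negative eigenvalue changes the frame only by a sign, which acts trivially. *)
  have dgN : pt (g *m G *m (dg `|lam| *m flow t)) = pt (S *m (g *m G *m flow t)).
    have -> : S *m (g *m G *m flow t) = g *m G *m (dg lam *m flow t).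
      by rewrite mulmxA SG !mulmxA.
    case: (ger0P lam) => // _; rewrite -pt_opp.
    by rewrite -mulmxN -mulNmx /dg opp_mx2 !oppr0 invrN !opprK.
  by rewrite dgN surface_proj_deck // det_mulmx1 ?det_flow.
- move=> x /mem[S' [Q1 [Q2 [XS' S'E QE [m c1] [n c2]]]]].
  exists S', (Q2 *m G); split => //; first by rewrite mulmxA S'E mulmxA.
  by apply: aligned_cone c1 c2 aG l0 _; rewrite -QE.
Qed.

End Chains.

(** * Closeness of geodesics with aligned frames *)

Section Alignment.
Variable R : realType.
Implicit Types (A Q G W V g : 'M[R]_2) (x y u v k a d l eps : R).

(** For W = (p q; r s) the shift tau with e^tau = s / p makes the two diagonal entries of the
    relative frame V equal. Then fro V - 2 is 2 q r plus the squares of the off-diagonal entries,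
    all at most of order k^2 e^(2l) because p s = 1 + q r is at most 2. *)
Lemma aligned_close l eps k W : 0 <= l -> 0 < eps -> eps <= 1 / 2 ->
  0 <= k -> 8 * k * expR l <= eps -> aligned k W ->
  exists tau, forall g t, \det g = 1 -> 0 <= t <= l ->
    hdist (pt (g *m flow t)) (pt (g *m W *m flow (tau + t))) < eps.
Proof.
move=> l0 e0 e1 k0 kl [dW]; have Y1 : 1 <= expR l by rewrite -expR0 ler_expR.
have k1 : k <= 1 / 8 by nra.
have [p [q [r [s E]]]] : exists p q r s, W = mx2 p q r s.
  by exists (W 0 0), (W 0 1), (W 1 0), (W 1 1); exact: mx2_eta.
move: dW; rewrite E det_mx2 !mx2E => dW rp qs.
have ps_ge : `|q * r| <= k ^+ 2 * `|p * s|.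
  rewrite !normrM; have := ler_pM (normr_ge0 _) (normr_ge0 _) qs rp; lra.
have k2 : k ^+ 2 <= 1 / 64 by rewrite expr2; nra.
have qr_le : `|q * r| <= 1 / 64 * `|p * s| by apply: le_trans ps_ge _; rewrite ler_wpM2r.
have ps0 : 0 < p * s.
  rewrite ltNge; apply/negP => h; move: qr_le; rewrite (ler0_norm h) ler_norml.
  by move=> /andP[]; lra.
have ps2 : p * s <= 2.
  by move: qr_le; rewrite (gtr0_norm ps0) ler_norml => /andP[]; lra.
have p0 : p != 0 by apply: contraTneq ps0 => ->; rewrite mul0r ltxx.
have s0 : s != 0 by apply: contraTneq ps0 => ->; rewrite mulr0 ltxx.
have sp : 0 < s / p.
  rewrite (_ : s / p = p * s * (p^-1) ^+ 2); last by field.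
  by rewrite mulr_gt0 // exprn_even_gt0 ?invr_eq0.
pose sg := Num.sqrt (s / p); have sg0 : 0 < sg by rewrite sqrtr_gt0.
have sgE : sg ^+ 2 = s / p by rewrite sqr_sqrtr // ltW.
exists (2 * ln sg) => g t detg /andP[t0 tl].
have dW' : \det (mx2 p q r s) = 1 by rewrite det_mx2.
rewrite hdist_pt ?det_mulmx1 ?det_flow // invmxM1 ?det_flow // invmx_flow.
rewrite -!mulmxA (mulKmx (unit_det1 detg)) flowD -dg_flow //.
have T0 := expR_gt0 t; have T1 : 1 <= expR t by rewrite -expR0 ler_expR.
have TY : expR t <= expR l by rewrite ler_expR.
set V := flow (- t) *m _.
have dV : \det V = 1.
  by rewrite /V !det_mulmx1 ?det_flow ?det_dg ?unit_gt0.
have froE : fro V = 2 + (q ^+ 2 * (p / s) * expR t ^- 2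
    + r ^+ 2 * (s / p) * expR t ^+ 2 + 2 * (q * r)).
  have h1 : expR (- t / 2) = (expR (t / 2))^-1 by rewrite mulNr expRN.
  have e2 := expR_half t; set e := expR (t / 2) in h1 e2.
  have en : e != 0 by rewrite gt_eqF // expR_gt0.
  rewrite /V /flow /dg !mulmx2 /fro !mx2E h1 -/e -e2 !invrK.
  have sgn : sg != 0 by rewrite gt_eqF.
  transitivity (sg ^+ 2 * p ^+ 2 + s ^+ 2 / sg ^+ 2 +
    (q ^+ 2 / sg ^+ 2 * (e ^+ 2) ^- 2 + r ^+ 2 * sg ^+ 2 * (e ^+ 2) ^+ 2)).
    by field; rewrite en sgn.
  rewrite sgE; transitivity (2 * (p * s) +
    (q ^+ 2 * (p / s) * (e ^+ 2) ^- 2 + r ^+ 2 * (s / p) * (e ^+ 2) ^+ 2)).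
    by field; rewrite en p0 s0.
  have -> : p * s = 1 + q * r by lra.
  by ring.
have x0 := fro_ge2 dV.
have -> : fro V / 2 = 1 + (fro V - 2) / 2 by field.
apply: arcosh_small => //; first lra.
set T := expR t in T0 T1 TY froE *; set Y := expR l in Y1 TY kl *.
have T2 : 1 <= T ^+ 2 by rewrite exprn_ege1.
have Y0 : 0 < Y by exact: lt_le_trans TY.
have TY2 : T ^+ 2 <= Y ^+ 2 by rewrite lerXn2r // nnegrE ltW.
have kps : 0 <= k ^+ 2 * (p * s) by rewrite mulr_ge0 ?sqr_ge0 // ltW.
have sq (x y : R) : `|x| <= k * `|y| -> x ^+ 2 <= k ^+ 2 * y ^+ 2.
  move=> h; rewrite -(real_normK (num_real x)) -(real_normK (num_real y)) -exprMn.
  by rewrite lerXn2r ?nnegrE // mulr_ge0.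
have b1 : q ^+ 2 * (p / s) * T ^- 2 <= k ^+ 2 * (p * s).
  have ps' : 0 <= p / s by rewrite -invf_div invr_ge0 ltW.
  have h : q ^+ 2 * (p / s) <= k ^+ 2 * (p * s).
    apply: le_trans (ler_wpM2r ps' (sq _ _ qs)) _.
    by rewrite le_eqVlt; apply/orP; left; apply/eqP; field.
  have IT : T ^- 2 <= 1 by rewrite invf_le1 // exprn_gt0.
  by apply: le_trans h; rewrite ler_piMr // mulr_ge0 ?sqr_ge0.
have b2 : r ^+ 2 * (s / p) * T ^+ 2 <= k ^+ 2 * (p * s) * Y ^+ 2.
  have h : r ^+ 2 * (s / p) <= k ^+ 2 * (p * s).
    apply: le_trans (ler_wpM2r (ltW sp) (sq _ _ rp)) _.
    by rewrite le_eqVlt; apply/orP; left; apply/eqP; field.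
  by apply: ler_pM => //; rewrite ?sqr_ge0 // mulr_ge0 ?sqr_ge0 // ltW.
have b3 : q * r <= k ^+ 2 * (p * s).
  by move: ps_ge; rewrite (gtr0_norm ps0) ler_norml => /andP[].
have Y2 : 1 <= Y ^+ 2 by rewrite exprn_ege1.
have b4 : k ^+ 2 * (p * s) <= 2 * k ^+ 2.
  by rewrite mulrC ler_wpM2r ?sqr_ge0.
have b5 : 64 * k ^+ 2 * Y ^+ 2 <= eps ^+ 2.
  have -> : 64 * k ^+ 2 * Y ^+ 2 = (8 * k * Y) ^+ 2 by ring.
  by rewrite lerXn2r ?nnegrE ?mulr_ge0 // ltW.
have b6 : k ^+ 2 * (p * s) <= k ^+ 2 * (p * s) * Y ^+ 2 by rewrite ler_peMr.
have b7 : k ^+ 2 * (p * s) * Y ^+ 2 <= 2 * k ^+ 2 * Y ^+ 2.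
  by rewrite ler_wpM2r // sqr_ge0.
have e2 := sqr_ge0 eps.
rewrite froE; clear - b1 b2 b3 b5 b6 b7 e2; lra.
Qed.

(** On the cone of slope k, the inverse of V produces one coordinate of size at most (d + 2k) |x|
    and another of size at least |x| / 4, hence slope 4d + 8k. The second column is treated
    alike. *)
Lemma aligned_invl k d V W : 0 <= k -> k <= 1 / 8 -> d <= 1 / 8 -> \det V = 1 ->
  1 / 2 <= V 0 0 <= 2 -> 1 / 2 <= V 1 1 <= 2 -> `|V 0 1| <= d -> `|V 1 0| <= d ->
  aligned k W -> aligned (4 * d + 8 * k) (invmx V *m W).
Proof.
move=> k0 k1 d1 dV /andP[a1 a2] /andP[c1 c2] b01 b10 [dW w1 w2].
have dd : 0 <= d by apply: le_trans b01.
have main (a b c e x y : R) : 1 / 2 <= a -> `|b| <= d -> `|c| <= d -> 0 <= e <= 2 ->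
    `|y| <= k * `|x| -> `|c * x + e * y| <= (4 * d + 8 * k) * `|a * x + b * y|.
  move=> ha hb hc /andP[e0 he] yx; have X0 := normr_ge0 x.
  have l1 : `|c * x + e * y| <= (d + 2 * k) * `|x|.
    apply: le_trans (ler_normD _ _) _; rewrite !normrM (ger0_norm e0).
    have : `|c| * `|x| <= d * `|x| by rewrite ler_wpM2r.
    have : e * `|y| <= 2 * (k * `|x|) by rewrite ler_pM.
    lra.
  have l2 : 1 / 4 * `|x| <= `|a * x + b * y|.
    have := lerB_normD (a * x) (b * y); rewrite !normrM.
    rewrite (ger0_norm (_ : 0 <= a)); last lra.
    have : `|b| * `|y| <= d * (k * `|x|) by rewrite ler_pM.
    have : d * (k * `|x|) <= 1 / 8 * (1 / 8 * `|x|).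
      by rewrite ler_pM ?mulr_ge0 // ler_wpM2r.
    have : 1 / 2 * `|x| <= a * `|x| by rewrite ler_wpM2r.
    lra.
  apply: le_trans l1 _.
  have -> : (d + 2 * k) * `|x| = (4 * d + 8 * k) * (1 / 4 * `|x|) by field.
  by rewrite ler_wpM2l //; lra.
split; first by rewrite det_mulmx1 ?det_invmx1.
  rewrite invmx2 // !mulmx2E !mx2E; apply: main; rewrite ?normrN //.
  by apply/andP; split; lra.
rewrite invmx2 // !mulmx2E !mx2E [X in `|X| <= _]addrC [X in _ <= _ * `|X|]addrC.
apply: main; rewrite ?normrN //; by apply/andP; split; lra.
Qed.

(** The conjugation multiplies slopes by a^2 and inverse slopes by a^-2. *)
Lemma aligned_dg k m a W : 0 <= k -> 0 < a -> a ^+ 2 <= m -> a ^- 2 <= m ->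
  aligned k W -> aligned (m * k) (dg a^-1 *m W *m dg a).
Proof.
move=> k0 a0 a1 a2 [dW w1 w2].
have a20 : 0 < a ^+ 2 by rewrite exprn_gt0.
have -> : dg a^-1 *m W *m dg a = mx2 (W 0 0) (W 0 1 * a ^- 2) (W 1 0 * a ^+ 2) (W 1 1).
  rewrite [W in LHS]mx2_eta /dg !mulmx2 invrK.
  by congr mx2; field; rewrite ?(gt_eqF a0).
split; first by rewrite det_mx2 -dW det2; field; rewrite gt_eqF.
  rewrite !mx2E normrM (gtr0_norm a20) -[m * k * _]mulrA [leRHS]mulrC.
  by apply: ler_pM => //; exact: ltW.
have aV0 : 0 < a ^- 2 by rewrite invr_gt0.
rewrite !mx2E normrM (gtr0_norm aV0) -[m * k * _]mulrA [leRHS]mulrC.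
by apply: ler_pM => //; exact: ltW.
Qed.

(** * A finite net of frames modulo the flow *)

Definition grid M d : seq R :=
  [seq i%:R * d - M | i <- iota 0 (Num.trunc (2 * M / d)).+1].

Lemma size_grid M d : 0 < d -> d <= M -> (size (grid M d))%:R <= 3 * M / d.
Proof.
move=> d0 dM; rewrite size_map size_iota -natr1.
have h : 0 <= 2 * M / d by rewrite divr_ge0 ?mulr_ge0 // ltW //; lra.
have /andP[+ _] := truncn_itv h.
have : 1 <= M / d by rewrite ler_pdivlMr // mul1r.
have -> : 3 * M / d = 2 * M / d + M / d by field; rewrite gt_eqF.
lra.
Qed.

Lemma gridP M d x : 0 < d -> `|x| <= M ->
  exists y, [/\ y \in grid M d, `|y| <= M & `|x - y| <= d].
Proof.
move=> d0; rewrite ler_norml => /andP[x1 x2].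
have z0 : 0 <= (x + M) / d by apply: divr_ge0; lra.
have /andP[h1] := truncn_itv z0; rewrite -natr1 => h2.
have le12 : (x + M) / d <= 2 * M / d by rewrite ler_wpM2r ?invr_ge0 ?(ltW d0) //; lra.
exists ((Num.trunc ((x + M) / d))%:R * d - M); split.
- apply/mapP; exists (Num.trunc ((x + M) / d)) => //.
  by rewrite mem_iota add0n ltnS /=; exact: le_truncn.
- move: h1; rewrite ler_pdivlMr // => h1; rewrite ler_norml.
  have := mulr_ge0 (ler0n R (Num.trunc ((x + M) / d))) (ltW d0).
  by move=> ?; apply/andP; split; lra.
- move: h1 h2; rewrite ler_pdivlMr // ltr_pdivrMr // => h1 h2.
  by rewrite ler_norml; apply/andP; split; lra.
Qed.

(* [lu y x] is (1 0; y 1) times (1 x; 0 1). *)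
Definition lu y x : 'M[R]_2 := mx2 1 x y (1 + x * y).

(** Frames are factored as lower times upper unipotent times diagonal, and the diagonal factor, a
    flow, is dropped. The second half exchanges the rows, for frames whose first column has the
    larger entry below. *)
Definition net M d : seq 'M[R]_2 :=
  [seq lu y x | y <- grid M d, x <- grid M d] ++
  [seq mx2 0 (- 1) 1 0 *m lu y x | y <- grid M d, x <- grid M d].

Lemma det_lu y x : \det (lu y x) = 1.
Proof. by rewrite det_mx2; ring. Qed.

Lemma det_weyl : \det (mx2 0 (- 1) 1 0 : 'M[R]_2) = 1.
Proof. by rewrite det_mx2; ring. Qed.

Lemma det_net M d g : g \in net M d -> \det g = 1.
Proof.
rewrite mem_cat => /orP[/allpairsP[[y z] /= [_ _ ->]]|].
  exact: det_lu.
by move=> /allpairsP[[y z] /= [_ _ ->]]; rewrite det_mulmx1 ?det_weyl ?det_lu.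
Qed.

Lemma size_net M d : 0 < d -> d <= M -> (size (net M d))%:R <= 2 * (3 * M / d) ^+ 2.
Proof.
move=> d0 dM; rewrite size_cat !size_allpairs natrD natrM.
have h := size_grid d0 dM; have := ler_pM (ler0n R _) (ler0n R _) h h; lra.
Qed.

(** When |c| <= |a|, the matrix (a b; c e) is lu (c / a) (a b) dg a. Both parameters are bounded by
    M and rounded to the grid, V being the resulting error; a^-2 is bounded because the first column
    cannot be short. The sign lets a be positive. *)
Lemma netP M d g : 2 <= M -> 0 < d -> d * M <= 1 / 2 -> \det g = 1 -> fro g <= M ->
  exists G V a, [/\ G \in net M d, 0 < a /\ a ^+ 2 <= 2 * M /\ a ^- 2 <= 2 * M,
    [/\ \det V = 1, 1 / 2 <= V 0 0 <= 2, 1 / 2 <= V 1 1 <= 2,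
        `|V 0 1| <= (1 + M ^+ 2) * d & `|V 1 0| <= (1 + M ^+ 2) * d] &
    g = G *m V *m dg a \/ g = - (G *m V *m dg a)].
Proof.
move=> M2 d0 dM detg gM.
have M0 : 0 < M by lra.
have main (h : 'M[R]_2) : \det h = 1 -> fro h <= M -> `|h 1 0| <= `|h 0 0| ->
  exists x y V a, [/\ x \in grid M d, y \in grid M d,
    0 < a /\ a ^+ 2 <= 2 * M /\ a ^- 2 <= 2 * M,
    [/\ \det V = 1, 1 / 2 <= V 0 0 <= 2, 1 / 2 <= V 1 1 <= 2,
        `|V 0 1| <= (1 + M ^+ 2) * d & `|V 1 0| <= (1 + M ^+ 2) * d] &
    h = lu y x *m V *m dg a \/ h = - (lu y x *m V *m dg a)].
  move=> dh hM h10; move: dh hM; rewrite det2 /fro.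
  have hE := mx2_eta h; move: hE h10.
  move: (h 0 0) (h 0 1) (h 1 0) (h 1 1) => a b c e hE ca dh hM.
  have a0 : a != 0.
    apply/eqP => a0; move: ca dh; rewrite a0 normr0 normr_le0 => /eqP ->.
    by rewrite mul0r mulr0 subr0 => /esym/eqP; rewrite oner_eq0.
  have c2 : c ^+ 2 <= a ^+ 2.
    by rewrite -(real_normK (num_real c)) -(real_normK (num_real a)) lerXn2r ?nnegrE.
  have [a2 b2 c20 e2] : [/\ 0 <= a ^+ 2, 0 <= b ^+ 2, 0 <= c ^+ 2 & 0 <= e ^+ 2].
    by rewrite !sqr_ge0.
  have a20 : 0 < a ^+ 2 by rewrite exprn_even_gt0.
  have aI : a ^- 2 <= 2 * M.
    have lag : 1 <= (a ^+ 2 + c ^+ 2) * (b ^+ 2 + e ^+ 2).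
      have := congr1 (fun r => r ^+ 2) dh; have := sqr_ge0 (a * b + c * e).
      by rewrite expr1n; lra.
    rewrite -[leLHS]mul1r ler_pdivrMr //; apply: le_trans lag _.
    rewrite mulrC; have : (b ^+ 2 + e ^+ 2) * (a ^+ 2 + c ^+ 2) <= M * (2 * a ^+ 2).
      by apply: ler_pM; lra.
    lra.
  have y1 : `|c / a| <= 1.
    by rewrite normrM normfV ler_pdivrMr ?normr_gt0 // mul1r.
  have x1 : `|a * b| <= M.
    have := sqr_ge0 (a - b); have := sqr_ge0 (a + b).
    by move=> h1 h2; rewrite ler_norml; apply/andP; split; lra.
  have [|y [yg yM yd]] := gridP (M := M) (x := c / a) d0; first by lra.
  have [x [xg xM xd]] := gridP d0 x1.
  pose V := invmx (lu y x) *m lu (c / a) (a * b).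
  have dV : \det V = 1 by rewrite det_mulmx1 ?det_invmx1 ?det_lu.
  have VE : V = mx2 (1 - x * (c / a - y))
      ((a * b - x) - x * (c / a - y) * (a * b)) (c / a - y)
      (1 + (c / a - y) * (a * b)).
    by rewrite /V invmx2 ?det_lu // /lu !mx2E mulmx2; congr mx2; ring.
  have hV : h = lu y x *m V *m dg a.
    rewrite /V mulmxA mulmxV ?unit_det1 ?det_lu // mul1mx hE /lu /dg mulmx2.
    have -> : e = (1 + b * c) / a by apply: (mulIf a0); rewrite divfK //; lra.
    by congr mx2; field.
  have bd (u v w : R) : `|u| <= M -> `|v| <= d -> `|u * v| <= 1 / 2.
    move=> hu hv; rewrite normrM; apply: le_trans (ler_pM _ _ hu hv) _ => //.
    by rewrite mulrC.
  have dd : 0 <= M ^+ 2 * d by rewrite mulr_ge0 ?sqr_ge0 // ltW.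
  exists x, y, V, `|a|; split => //.
  - rewrite normr_gt0 a0; split => //; rewrite real_normK ?num_real //.
    by split => //; lra.
  - split => //; rewrite VE !mx2E.
    + have := bd x (c / a - y) 0 xM yd; rewrite ler_norml => /andP[h1 h2].
      by apply/andP; split; lra.
    + have := bd (a * b) (c / a - y) 0 x1 yd; rewrite ler_norml => /andP[h1 h2].
      by apply/andP; split; lra.
    + apply: le_trans (ler_normB _ _) _.
      have : `|x * (c / a - y) * (a * b)| <= M ^+ 2 * d.
        rewrite normrM (normrM x) mulrAC expr2.
        by apply: ler_pM; rewrite ?mulr_ge0 // ler_pM.
      lra.
    + by apply: le_trans yd _; lra.
  - have [a1|a1] := leP 0 a; first by left; rewrite ger0_norm.
    by right; rewrite ltr0_norm // hV -mulmxN /dg opp_mx2 !oppr0 invrN !opprK.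
have [h|/ltW h] := leP `|g 1 0| `|g 0 0|.
  have [x [y [V [a [xg yg ha hV hg]]]]] := main g detg gM h.
  exists (lu y x), V, a; split => //.
  by rewrite mem_cat; apply/orP; left; apply/allpairsP; exists (y, x).
pose g' := invmx (mx2 0 (- 1) 1 0) *m g.
have g'E : g' = mx2 (g 1 0) (g 1 1) (- g 0 0) (- g 0 1).
  by rewrite /g' invmx2 ?det_weyl // {1}(mx2_eta g) !mx2E mulmx2; congr mx2; ring.
have gE : g = mx2 0 (- 1) 1 0 *m g'.
  by rewrite /g' mulmxA mulmxV ?unit_det1 ?det_weyl // mul1mx.
have dg' : \det g' = 1 by rewrite det_mulmx1 ?det_invmx1 ?det_weyl.
have fg' : fro g' <= M.
  by move: gM; rewrite g'E /fro !mx2E !sqrrN; lra.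
have [|x [y [V [a [xg yg ha hV hg]]]]] := main g' dg' fg'.
  by rewrite g'E !mx2E normrN.
exists (mx2 0 (- 1) 1 0 *m lu y x), V, a; split => //.
  by rewrite mem_cat; apply/orP; right; apply/allpairsP; exists (y, x).
by rewrite gE; case: hg => ->; [left|right]; rewrite ?mulmxN !mulmxA.
Qed.

End Alignment.

(** * Density of a geodesic aligned with every frame of the net *)

Section Density.
Variables (R : realType) (X : hyp_surface R).
Implicit Types (G : 'M[R]_2) (l eps M k d : R).

(** A segment with frame g is moved by the deck group to h = F V dg a up to sign, with F in the net.
    From S G = F W one gets S G dg a = h W2 up to the same sign, where W2 = dg a^-1 V^-1 W dg a is
    still aligned. So the translate of the geodesic, shifted in time by 2 ln a + tau, follows the
    segment. *)
Lemma dense_of_net l eps M k d G : 0 < l -> 0 < eps -> eps <= 1 / 2 ->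
  2 <= M -> 0 <= k -> k <= 1 / 8 -> 0 < d -> d * M <= 1 / 2 ->
  (1 + M ^+ 2) * d <= 1 / 8 ->
  8 * (2 * M * (4 * ((1 + M ^+ 2) * d) + 8 * k)) * expR l <= eps ->
  (forall g, \det g = 1 -> exists2 A, deck X A & fro (A *m g) <= M) ->
  \det G = 1 ->
  (forall F, F \in net M d ->
    exists S W, [/\ deck X S, S *m G = F *m W & aligned k W]) ->
  dense_in_UT l eps (fun t => surface_proj X (pt (G *m flow t))).
Proof.
move=> l0 e0 e1 M2 k0 k1 d0 dM dM1 small cM dG near c [ct [ctg ctc]].
have [g detg gE] := hgeodesic_flow l0 ctg.
have [A XA AM] := cM _ detg; have dA := deck_det XA.
have dh := det_mulmx1 dA detg; set h := A *m g in AM dh.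
have [F [V [a [Fnet [a0 [am aVm]] [dV V00 V11 V01 V10] hE]]]] :=
  netP M2 d0 dM dh AM.
have [S [W [XS SW aW]]] := near F Fnet.
have aW1 := aligned_invl k0 k1 dM1 dV V00 V11 V01 V10 aW.
have k2 : 0 <= 4 * ((1 + M ^+ 2) * d) + 8 * k.
  by rewrite addr_ge0 // mulr_ge0 // mulr_ge0 ?(ltW d0) // addr_ge0 ?sqr_ge0.
have aW2 := aligned_dg k2 a0 am aVm aW1; set W2 := _ *m dg a in aW2.
have k3 : 0 <= 2 * M * (4 * ((1 + M ^+ 2) * d) + 8 * k).
  by rewrite mulr_ge0 // mulr_ge0 // (le_trans _ M2).
have [tau close] := aligned_close (ltW l0) e0 e1 k3 small aW2.
have SE t : pt (h *m W2 *m flow (tau + t)) =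
    pt (S *m (G *m flow (2 * ln a + tau + t))).
  have -> : S *m (G *m flow (2 * ln a + tau + t)) =
      F *m W *m dg a *m flow (tau + t).
    by rewrite -addrA flowD -dg_flow // !mulmxA SW.
  have FW : F *m V *m dg a *m W2 = F *m W *m dg a.
    have au := unit_gt0 a0.
    rewrite /W2 !mulmxA -(mulmxA _ (dg a)) dgM ?unitrV // divrr // dg1 mulmx1.
    by rewrite -(mulmxA F) mulmxV ?unit_det1 // mulmx1.
  by case: hE => ->; rewrite ?mulNmx FW ?pt_opp.
exists (2 * ln a + tau), (fun t => pt (h *m flow t)),
  (fun t => pt (S *m G *m flow (2 * ln a + tau + t))).
have dSG : \det (S *m G) = 1 by rewrite det_mulmx1 ?(deck_det XS).
split.
- split; first exact: hgeodesic_line.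
  move=> t tl; rewrite -ctc // gE; last by move: tl; rewrite inE /= in_itv.
  by rewrite -mulmxA surface_proj_deck // det_mulmx1 ?det_flow.
- split; last first.
    by move=> t _; rewrite -mulmxA surface_proj_deck // det_mulmx1 ?det_flow.
  by move=> s t _ _; rewrite hdist_line //; congr `|_|; ring.
- move=> t; rewrite inE /= ?in_itv /= => tl.
  by rewrite -mulmxA -SE; exact: close.
Qed.

End Density.

(** * Choice of the scales in terms of eps *)

Section Scales.
Variable R : realType.
Implicit Types (K M Y eps B C : R).

(** With k = c1 eps and d = d1 eps, each of the two terms of the alignment error is at most eps / 2.
    The second summand in the inverse of [c1] yields the last inequality, whose summand 1 makes K /
    k at least 1. *)
Lemma cone_and_net_scales K (E0 : R) M Y : 0 < K -> 0 < E0 -> 2 <= M -> 1 <= Y ->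
  exists c1 d1 : R, [/\ 0 < c1, 0 < d1 & forall eps, 0 < eps -> eps <= 1 / 2 ->
    [/\ c1 * eps <= 1 / 8, d1 * eps * M <= 1 / 2, (1 + M ^+ 2) * (d1 * eps) <= 1 / 8,
      8 * (2 * M * (4 * ((1 + M ^+ 2) * (d1 * eps)) + 8 * (c1 * eps))) * Y <= eps &
      E0 + 1 <= K / (c1 * eps)]].
Proof.
move=> K0 E00 M2 Y1; have MY : 2 <= M * Y by rewrite -[leLHS]mulr1 ler_pM.
have N1 : 0 < 1 + M ^+ 2 by rewrite ltr_wpDr ?sqr_ge0.
have q0 : 0 < (E0 + 1) / K by rewrite divr_gt0 //; lra.
have e0 : 0 < 256 * (M * Y) + (E0 + 1) / K by clear - MY q0; lra.
pose c1 := (256 * (M * Y) + (E0 + 1) / K)^-1.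
pose d1 := (128 * (M * Y) * (1 + M ^+ 2))^-1.
have c10 : 0 < c1 by rewrite invr_gt0.
have d1V : 0 < 128 * (M * Y) * (1 + M ^+ 2) by rewrite !mulr_gt0 //; lra.
have d10 : 0 < d1 by rewrite invr_gt0.
exists c1, d1; split => // eps eps0 eps1.
have cE : 256 * (M * Y) * (c1 * eps) <= eps.
  rewrite [_ * (c1 * eps)]mulrA ler_piMl ?(ltW eps0) // /c1 ler_pdivrMr //.
  by clear - q0; lra.
have dE : 128 * (M * Y) * ((1 + M ^+ 2) * (d1 * eps)) = eps.
  transitivity (128 * (M * Y) * (1 + M ^+ 2) * d1 * eps); first by ring.
  by rewrite /d1 divff ?mul1r // gt_eqF.
have k0 : 0 < c1 * eps by rewrite mulr_gt0.
have d0 : 0 < d1 * eps by rewrite mulr_gt0.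
set k := c1 * eps in cE k0 *; set d := d1 * eps in dE d0 *.
have Nd0 : 0 < (1 + M ^+ 2) * d by rewrite mulr_gt0.
have kMY : k * 2 <= k * (M * Y) by rewrite ler_pM2l.
have dMY : (1 + M ^+ 2) * d * 2 <= (1 + M ^+ 2) * d * (M * Y) by rewrite ler_pM2l.
have dM : d * M <= (1 + M ^+ 2) * d.
  rewrite mulrC ler_pM2r //; clear - M2; have := sqr_ge0 (M - 1); rewrite sqrrB; lra.
split.
- by clear - cE kMY eps1; lra.
- by clear - dE dMY dM eps1; lra.
- by clear - dE dMY eps1; lra.
- have -> : 8 * (2 * M * (4 * ((1 + M ^+ 2) * d) + 8 * k)) * Y =
    64 * (M * Y) * ((1 + M ^+ 2) * d) + 128 * (M * Y) * k by ring.
  by clear - cE dE eps0; lra.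
- rewrite ler_pdivlMr // /k mulrCA; apply: (@le_trans _ _ (c1 * (E0 + 1))).
    by rewrite ler_pM2l // ler_piMr //; clear - E00 eps1; lra.
  rewrite mulrC -ler_pdivlMr // /c1 invrK mulrDr [K * (_ / K)]mulrC divfK ?gt_eqF //.
  have := mulr_ge0 (ltW K0) (le_trans (ler0n R 2) MY).
  by clear; lra.
Qed.

(** Since ln (1 / eps) >= ln 2, the constant ln B is absorbed into a multiple of the logarithm. *)
Lemma ln_div_le B : 1 <= B -> exists2 C, 0 < C & forall eps, 0 < eps ->
  eps <= 1 / 2 -> ln (B / eps) <= C * ln (1 / eps).
Proof.
move=> B1; have ln2 : 0 < ln 2 :> R by rewrite ln_gt0 // ltr1n.
have lnB : 0 <= ln B by exact: ln_ge0.
exists (ln B / ln 2 + 1); first by rewrite ltr_wpDl // divr_ge0 // ltW.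
move=> eps e0 e1; have e2 : 2 <= eps^-1 by rewrite -[leRHS]div1r ler_pdivlMr //; lra.
have lne : ln 2 <= ln (1 / eps) by rewrite div1r ler_ln ?posrE ?invr_gt0.
have -> : ln (B / eps) = ln B + ln (1 / eps).
  by rewrite div1r lnM ?posrE ?invr_gt0 // (lt_le_trans ltr01).
rewrite mulrDl [1 * ln _]mul1r lerD2r.
rewrite -[leLHS](divfK (lt0r_neq0 ln2)).
by rewrite ler_wpM2l // divr_ge0 // ltW.
Qed.

End Scales.

(** * Assembling the geodesic and its length bound *)

Theorem theorem3p1 (R : realType) (g : nat) (hg : (2 <= g)%N)
    (X : hyp_surface R) (X_closed : compact [set: points X])
    (X_genus : has_genus X g)
    (l : R) (l_gt0 : 0 < l) (l_le : (l%:E <= injrad X)%E) :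
  exists2 C : R, 0 < C &
    forall eps : R, 0 < eps -> eps <= 1 / 2 ->
      exists (gamma : R -> points X) (L : R),
        [/\ closed_geodesic gamma L,
            dense_in_UT l eps gamma &
            L <= C * (1 / eps ^+ 2) * ln (1 / eps)].
Proof.
have [M M2 cM] := cocompact X_closed.
have [K [b [E0 [K0 b1 E00 conn]]]] := connecting_element X_closed.
have Y1 : 1 <= expR l by rewrite -expR0 ler_expR ltW.
have [c1 [d1 [c10 d10 scales]]] := cone_and_net_scales K0 E00 M2 Y1.
(* The largest admissible eps gives the lower bound on K / c1 behind [1 <= B]. *)
have [_ _ _ _ Kc1] := scales (1 / 2) ltac:(by []) (lexx _).
pose B := 2 * b * (K / c1).
have B1 : 1 <= B.
  have h : 1 <= 2 * (K / c1).
    have E : K / (c1 * (1 / 2)) = 2 * (K / c1) by field; rewrite gt_eqF.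
    by rewrite -E; apply: le_trans Kc1; rewrite lerDr ltW.
  by rewrite /B mulrAC -[leLHS]mulr1; exact: ler_pM.
have [C' C'0 lnB] := ln_div_le B1.
(* N / eps^2 bounds the number of frames; the summand 1 pays for the identity frame placed before
   the net. *)
pose N := 2 * (3 * M / d1) ^+ 2 + 1.
have N0 : 0 < N by rewrite ltr_wpDl // mulr_ge0 // sqr_ge0.
exists (2 * N * C'); first by rewrite !mulr_gt0.
move=> eps e0 e1; have [k18 dM dM8 small KE] := scales eps e0 e1.
set k := c1 * eps in k18 small KE; set d := d1 * eps in dM dM8 small.
have k0 : 0 < k by rewrite mulr_gt0.
have d0 : 0 < d by rewrite mulr_gt0.
(* E^2 = e^T is of order 1 / eps, so each link costs a length of order log (1 / eps). *)
pose E := Num.sqrt (K / k).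
have E2 : E ^+ 2 = K / k by rewrite sqr_sqrtr // divr_ge0 ?ltW.
have KE0 : E0 <= K / k by apply: le_trans KE; rewrite lerDl.
have KE1 : 1 <= K / k by apply: le_trans KE; rewrite lerDr ltW.
have E1 : 1 <= E by rewrite -[leLHS]sqrtr1 ler_sqrt // divr_ge0 ?ltW.
have BE : 2 * b * E ^+ 2 = B / eps.
  by rewrite E2 /B /k; field; rewrite !gt_eqF.
have Beps : 1 <= B / eps.
  rewrite ler_pdivlMr // mul1r (le_trans e1) // (le_trans _ B1) //.
  by rewrite ler_pdivrMr // mul1r ler1n.
have link g0 h0 : \det g0 = 1 -> \det h0 = 1 ->
    exists2 S, deck X S & cone k (B / eps) 1 (invmx g0 *m S *m h0).
  have kE : k = K / E ^+ 2 by rewrite E2 invf_div mulrC divfK // gt_eqF.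
  have k1 : k <= 1 by rewrite (le_trans k18) // ler_pdivrMr // mul1r ler1n.
  by rewrite -BE; apply: conn => //; rewrite E2.
have k01 : 0 <= k <= 1 / 2.
  by rewrite ltW //= (le_trans k18) // ler_wpM2l // lef_pV2 ?posrE // ler_nat.
(* The identity serves as the starting frame, so that the chain has a head. *)
have dets x : x \in 1%:M :: net M d -> \det x = 1.
  by rewrite inE => /orP[/eqP ->|/det_net //]; rewrite det1.
have [G [L [dG /andP[L0 LB] per near]]] := chain_axis k01 Beps link dets.
exists (fun t => surface_proj X (pt (G *m flow t))), L; split.
- split => //; exists (fun t => pt (G *m flow t)).
  by split => //; exact: hgeodesic_line.
- apply: (dense_of_net l_gt0 e0 e1 M2 (ltW k0) k18 d0 dM dM8 small cM dG).
  by move=> F Fnet; apply: near; rewrite inE Fnet orbT.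
- apply: le_trans LB _.
  have dM' : d <= M.
    by rewrite (le_trans _ M2) // (le_trans _ (_ : 1 / 2 <= 2)) //; nra.
  have eV : 1 <= 1 / eps ^+ 2.
    by rewrite ler_pdivlMr ?exprn_gt0 // mul1r exprn_ile1 ?ltW //; lra.
  have hs : (size (net M d)).+1%:R <= N * (1 / eps ^+ 2).
    rewrite -natr1 /N mulrDl mul1r; apply: lerD => //.
    apply: le_trans (size_net d0 dM') _.
    rewrite le_eqVlt; apply/orP; left; apply/eqP.
    by rewrite /d; field; rewrite !gt_eqF.
  have -> : 2 * N * C' * (1 / eps ^+ 2) * ln (1 / eps) =
    2 * ((N * (1 / eps ^+ 2)) * (C' * ln (1 / eps))) by ring.
  rewrite -mulrA ler_pM2l //; apply: ler_pM => //; last exact: lnB.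
  by rewrite ln_ge0.
Qed.
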